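(* Consider a port-Hamiltonian descriptor system $(E,J,R,Q,B)$ with $A=(J-R)Q$, $C=B^\top Q$, $(E,A)$ regular, $(E,A,B)$ strongly stabilizable and $(E,A,C)$ strongly detectable, and let $r=\mathrm{rank}(E)$. (i) There exist $S,T\in\mathrm{GL}(n)$ such that the transformed pH system $(\widetilde E,\widetilde J,\widetilde R,\widetilde Q,\widetilde B)$ is semi-explicit and all stabilizing solutions $\widetilde{\mathcal P}_{\mathrm c},\widetilde{\mathcal P}_{\mathrm f}$ of (GC), (GF) associated with the transformed system satisfy $\widetilde{\mathcal P}_{\mathrm f}\widetilde E^\top=\mathrm{diag}(\Sigma,\Sigma_2,0,0,0)$, $\widetilde E^\top\widetilde{\mathcal P}_{\mathrm c}=\mathrm{diag}(\Sigma,0,\Sigma_3,0,0)$ (same block partition in both, the last diagonal block being of size $n-r$), where $\Sigma=\mathrm{diag}(\sigma_1,\dots,\sigma_k)$ with $\sigma_1\ge\sigma_2\ge\dots\ge\sigma_k>0$, and $\Sigma_2,\Sigma_3$ are positive definite diagonal matrices (possibly of size zero). (ii) If $Q$ is invertible, then $\widetilde Q$ from (i) has the block structure $\widetilde Q=\begin{bmatrix}\widetilde Q_{11}&0\\ \widetilde Q_{21}&\widetilde Q_{22}\end{bmatrix}$ with $\widetilde Q_{11}\in\mathbb{R}^{r\times r}$ diagonal.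
   Context: A pH descriptor system: $E,J,R,Q\in\mathbb{R}^{n\times n}$, $B\in\mathbb{R}^{n\times m}$, $E^\top Q=Q^\top E\succeq0$, $J^\top=-J$, $R=R^\top\succeq0$, $A:=(J-R)Q$, $C:=B^\top Q$. Semi-explicit: $E=\mathrm{diag}(I_r,0)$. For $S,T$ invertible, the transformed pH system is $\widetilde E=SET^{-1}$, $\widetilde J=SJS^\top$, $\widetilde R=SRS^\top$, $\widetilde Q=S^{-\top}QT^{-1}$, $\widetilde B=SB$, with $\widetilde A=SAT^{-1}$, $\widetilde C=\widetilde B^\top\widetilde Q=CT^{-1}$. Regular pencil: $\det(sE-A)\ne0$ for some $s$; impulse-free: nilpotent part of Weierstraß form vanishes. $(E,A,B)$ strongly stabilizable: $\mathrm{rank}[E\ \ AS\ \ B]=n$ ($\mathrm{im}\,S=\ker E$) and $\mathrm{rank}[\lambda E-A\ \ B]=n$ for all $\mathrm{Re}\,\lambda\ge0$; $(E,A,C)$ strongly detectable: $(E^\top,A^\top,C^\top)$ strongly stabilizable. GAREs: (GC) $A^\top\mathcal P_{\mathrm c}+\mathcal P_{\mathrm c}^\top A-\mathcal P_{\mathrm c}^\top BB^\top\mathcal P_{\mathrm c}+C^\top C=0$, $E^\top\mathcal P_{\mathrm c}=\mathcal P_{\mathrm c}^\top E$; (GF) $A\mathcal P_{\mathrm f}^\top+\mathcal P_{\mathrm f}A^\top-\mathcal P_{\mathrm f}C^\top C\mathcal P_{\mathrm f}^\top+BB^\top+2R=0$, $E\mathcal P_{\mathrm f}^\top=\mathcal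 P_{\mathrm f}E^\top$. Stabilizing: $(E,A-BB^\top\mathcal P_{\mathrm c})$, resp. $(E,A-\mathcal P_{\mathrm f}C^\top C)$, regular, impulse-free, all finite eigenvalues in the open left half-plane. *)

(* Defs.v *)
From HB Require Import structures.
From mathcomp Require Import all_boot all_order all_algebra.
From mathcomp Require Import reals.
From mathcomp Require Import complex.
Set Implicit Arguments. Unset Strict Implicit. Unset Printing Implicit Defensive.
Import Order.TTheory GRing.Theory Num.Theory.
Local Open Scope ring_scope.

Section PHDefs.
Variable R : realType.

Definition toC (p q : nat) (M : 'M[R]_(p, q)) : 'M[R[i]]_(p, q) :=
  map_mx (fun x => Complex x 0) M.

Definition psd (n : nat) (M : 'M[R]_n) : Prop :=
  M^T = M /\ forall x : 'cV[R]_n, 0 <= (x^T *m M *m x) 0 0.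

Definition pid_diag (n r : nat) : 'M[R]_n :=
  diag_mx (\row_(i < n) (if (i < r)%N then 1 else 0)).

Definition regular_pencil (n : nat) (E A : 'M[R]_n) : Prop :=
  exists s : R[i], \det (s *: toC E - toC A) != 0.

(* impulse-free: the (real) Weierstrass form P(sE-A)Q = diag(sI - J, sN - I)
   has vanishing nilpotent part N = 0, i.e. P E Q = diag(I_m,0) and
   P A Q = diag(J, I_(n-m)). *)
Definition impulse_free (n : nat) (E A : 'M[R]_n) : Prop :=
  exists (P Qm : 'M[R]_n) (m : nat),
    P \in unitmx /\ Qm \in unitmx /\
    P *m E *m Qm = pid_diag n m /\
    forall i j : 'I_n, (m <= i)%N \/ (m <= j)%N ->
      (P *m A *m Qm) i j = (i == j)%:R.

Definition finite_eigs_stable (n : nat) (E A : 'M[R]_n) : Prop :=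
  forall l : R[i], \det (l *: toC E - toC A) = 0 -> complex.Re l < 0.

Definition stable_pencil (n : nat) (E A : 'M[R]_n) : Prop :=
  [/\ regular_pencil E A, impulse_free E A & finite_eigs_stable E A].

(* strong stabilizability of (E, A, B); the columns of (kermx E^T)^T span ker E *)
Definition strongly_stabilizable (n m : nat) (E A : 'M[R]_n) (B : 'M[R]_(n, m))
  : Prop :=
  \rank (row_mx (row_mx E (A *m (kermx E^T)^T)) B) = n /\
  forall l : R[i], 0 <= complex.Re l ->
    \rank (row_mx (l *: toC E - toC A) (toC B)) = n.

Definition strongly_detectable (n p : nat) (E A : 'M[R]_n) (C : 'M[R]_(p, n))
  : Prop := strongly_stabilizable E^T A^T C^T.

Definition stab_GC (n m : nat) (E A : 'M[R]_n) (B : 'M[R]_(n, m))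
  (C : 'M[R]_(m, n)) (Pc : 'M[R]_n) : Prop :=
  [/\ A^T *m Pc + Pc^T *m A - Pc^T *m B *m B^T *m Pc + C^T *m C = 0,
      E^T *m Pc = Pc^T *m E &
      stable_pencil E (A - B *m B^T *m Pc)].

Definition stab_GF (n m : nat) (E A Rd : 'M[R]_n) (B : 'M[R]_(n, m))
  (C : 'M[R]_(m, n)) (Pf : 'M[R]_n) : Prop :=
  [/\ A *m Pf^T + Pf *m A^T - Pf *m C^T *m C *m Pf^T + B *m B^T + 2%:R *: Rd = 0,
      E *m Pf^T = Pf *m E^T &
      stable_pencil E (A - Pf *m C^T *m C)].

(* diagonal vectors for diag(Sigma, Sigma2, 0, 0, 0) and
   diag(Sigma, 0, Sigma3, 0, 0), block sizes k, k2, k3, (r-k-k2-k3), n-r *)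
Definition diagF (n k k2 : nat) (s s2 : nat -> R) : 'M[R]_n :=
  diag_mx (\row_(i < n)
    if (i < k)%N then s i else if (i < k + k2)%N then s2 (i - k)%N else 0).

Definition diagC (n k k2 k3 : nat) (s s3 : nat -> R) : 'M[R]_n :=
  diag_mx (\row_(i < n)
    if (i < k)%N then s i else if (i < k + k2)%N then 0
    else if (i < k + k2 + k3)%N then s3 (i - k - k2)%N else 0).

End PHDefs.

(* Main.v *)
Require Import Defs.
From HB Require Import structures.
From mathcomp Require Import all_boot all_order all_algebra.
From mathcomp Require Import reals boolp.
From mathcomp Require Import complex ring lra zify.
Set Implicit Arguments. Unset Strict Implicit. Unset Printing Implicit Defensive.
Import Order.TTheory GRing.Theory Num.Theory.
Local Open Scope ring_scope.
Local Open Scope sesquilinear_scope.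

(** If a Riccati equation has a stabilizing solution [P], its closed-loop pencil
    is impulse-free, so [E^T P] is determined by a pair [(V, K)] with
    [(A - G P) V = E V K] and [K] stable. The difference of two solutions then
    satisfies a Sylvester equation, which makes [E^T P] independent of the
    stabilizing [P], and a Lyapunov equation makes [E^T P] positive semidefinite.
    Both claims carry over to the filter equation by transposition. In
    semi-explicit coordinates the two semidefinite matrices [Pf E^T] and [E^T Pc]
    live on the first [r] coordinates, transform contragrediently, and can be
    diagonalized simultaneously by splitting off one eigenvector of their
    product at a time. When [Q] is invertible, [Q^-T] solves the filter equation
    and its closed loop has no eigenvalue in the open right half-plane; this is
    enough for [Pf E^T = E Q^-1], hence a diagonal [Pf E^T] forces the stated
    shape of [Q]. If one of the stabilizing solutions does not exist, diagonalizing
    [E^T Q] is enough. *)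

(** Any completion [Y0] of [w] to a basis works once multiples of [w] are subtracted from its rows:
    this kills [c] as soon as [w *m c] is nonzero, and the second hypothesis settles the other case.
    Such bases split off one vector at a time, both for the Lyapunov inequality and for the
    diagonalization. *)
Lemma adapted_basis (F : fieldType) n (w : 'rV[F]_(1 + n)) (c : 'cV[F]_(1 + n)) :
  w != 0 -> (w *m c = 0 -> c = 0) ->
  exists Y : 'M[F]_(n, 1 + n), col_mx w Y \in unitmx /\ Y *m c = 0.
Proof.
move=> w0 wc.
have [Y0 uY0] : exists Y0 : 'M[F]_(n, 1 + n), col_mx w Y0 \in unitmx.
  have rw : \rank w = 1%N by rewrite rank_rV w0.
  have Ew := mulmx_ebase w; rewrite rw in Ew.
  set K := row_ebase w in Ew; set a := col_ebase w in Ew.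
  have Ea : a = (a 0 0)%:M by rewrite [a]mx11_scalar mxE eqxx.
  have ua : a 0 0 != 0.
    have := col_ebase_unit w; rewrite -/a Ea unitmxE det_scalar expr1 unitfE.
    by rewrite mxE eqxx.
  (* [w] is [a 0 0] times the first row of [K], so rescaling that row turns it into [w]. *)
  pose Dg := block_mx (a 0 0)%:M 0 0 1%:M : 'M[F]_(1 + n).
  have uD : Dg \in unitmx.
    by rewrite unitmxE det_ublock det1 mulr1 det_scalar expr1 unitfE.
  exists (dsubmx (Dg *m K)).
  suff -> : w = usubmx (Dg *m K) by rewrite vsubmxK unitmx_mul uD row_ebase_unit.
  rewrite -[K]vsubmxK mul_block_col col_mxKu mul0mx addr0.
  rewrite -Ew -Ea -mulmxA; congr (_ *m _); rewrite -{1}[K]vsubmxK.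
  have -> : pid_mx 1 = row_mx 1%:M 0 :> 'M[F]_(1, 1 + n).
    exact: pid_mx_row.
  by rewrite mul_row_col mul1mx mul0mx addr0.
pose a := (w *m c) 0 0.
pose f := a^-1 *: (Y0 *m c).
exists (Y0 - f *m w); split.
  have -> : col_mx w (Y0 - f *m w) =
     block_mx 1%:M 0 (- f) 1%:M *m col_mx w Y0.
    by rewrite mul_block_col !mul1mx mul0mx addr0 mulNmx addrC.
  by rewrite unitmx_mul uY0 andbT unitmxE det_lblock !det1 mulr1 unitr1.
have [a0|a0] := eqVneq a 0.
  rewrite (wc _) ?mulmx0 //.
  by rewrite [LHS]mx11_scalar -/a a0 raddf0.
rewrite mulmxBl -mulmxA [w *m c]mx11_scalar -/a mul_mx_scalar scalerA mulfV //.
by rewrite scale1r subrr.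
Qed.

(** * Hermitian forms and the Lyapunov inequality *)

Section Hermitian.
Variable C : numClosedFieldType.

Definition hpsd n (M : 'M[C]_n) :=
  M^t* = M /\ forall x : 'rV[C]_n, 0 <= (x *m M *m x^t*) 0 0.

Lemma ct_mul m n p (A : 'M[C]_(m, n)) (B : 'M_(n, p)) :
  (A *m B)^t* = B^t* *m A^t*.
Proof. by rewrite trmx_mul map_mxM. Qed.

Lemma ctD m n (A B : 'M[C]_(m, n)) : (A + B)^t* = A^t* + B^t*.
Proof. by rewrite linearD map_mxD. Qed.

Lemma ctN m n (A : 'M[C]_(m, n)) : (- A)^t* = - A^t*.
Proof. by rewrite linearN map_mxN. Qed.

Lemma ctZ m n a (A : 'M[C]_(m, n)) : (a *: A)^t* = a^* *: A^t*.
Proof. by rewrite linearZ map_mxZ. Qed.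

Lemma ct0 m n : (0 : 'M[C]_(m, n))^t* = 0.
Proof. by rewrite trmx0 map_mx0. Qed.

Lemma hpsd_congr m n (M : 'M[C]_n) (G : 'M_(m, n)) :
  hpsd M -> hpsd (G *m M *m G^t*).
Proof.
case=> hM pM; split; first by rewrite !ct_mul trmxCK hM mulmxA.
by move=> x; have := pM (x *m G); rewrite ct_mul !mulmxA.
Qed.

(** Since the form vanishes at [x], its value at y - c x has no quadratic term in c, so it stays
    nonnegative only if the cross term is zero. Unit vectors for y give every entry of [x *m M]. *)
Lemma hpsd_ker n (M : 'M[C]_n) (x : 'rV_n) :
  hpsd M -> (x *m M *m x^t*) 0 0 = 0 -> x *m M = 0.
Proof.
case=> hM pM x0; apply/rowP=> j; rewrite [RHS]mxE.
pose y := delta_mx 0 j : 'rV[C]_n.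
pose z := (x *m M) 0 j.
have zE : (x *m M *m y^t*) 0 0 = z.
  rewrite /z /y; have -> : (delta_mx 0 j : 'rV[C]_n)^t* = delta_mx j 0.
    by apply/matrixP=> a b; rewrite !mxE andbC rmorph_nat.
  by rewrite -colE mxE.
have zE' : (y *m M *m x^t*) 0 0 = z^*.
  have -> : y *m M *m x^t* = (x *m M *m y^t*)^t*.
    by rewrite !ct_mul trmxCK hM mulmxA.
  by rewrite -zE mxE [X in X^* = _]mxE.
apply/eqP; rewrite -/z; apply: contraT => z0.
pose b := (y *m M *m y^t*) 0 0.
have b0 : 0 <= b by apply: pM.
(* With c equal to [s] times the conjugate of [z], the form at y - c x is b - 2(b + 1), which is
   negative. *)
pose s := (b + 1) / (z * z^*).
have zz : 0 < z * z^* by rewrite mul_conjC_gt0.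
have s0 : 0 <= s by rewrite divr_ge0 ?ltW // ltr_wpDl.
have := pM (y - (s * z^*) *: x).
have mxB (A B : 'M[C]_1) : (A - B) 0 0 = A 0 0 - B 0 0 by rewrite !mxE.
have mxZ (c : C) (A : 'M[C]_1) : (c *: A) 0 0 = c * A 0 0 by rewrite mxE.
rewrite ctD ctN ctZ mulmxBl mulmxBr !mulmxBl -!scalemxAl -!scalemxAr.
rewrite !(mxB, mxZ) -/b zE zE' x0.
rewrite !mulr0 subr0 rmorphM /= conjCK (geC0_conj s0) -mulrA (mulrC z^*).
have -> : s * (z * z^*) = b + 1 by rewrite divfK ?gt_eqF.
rewrite -[_ * z * _]mulrA divfK ?gt_eqF // => H.
have H1 : 1 + (b + 1) <= 0.
  by rewrite -oppr_ge0; move: H; congr (0 <= _); ring.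
have : 0 < 1 + (b + 1) by rewrite ltr_wpDr ?ltr01 // addr_ge0 // ler01.
by move=> /lt_le_trans /(_ H1); rewrite ltxx.
Qed.

(** [l + l^*] is twice the real part of [l]: the spectrum lies in the open left half-plane. *)
Definition hstable n (M : 'M[C]_n) :=
  forall l, \det (l%:M - M) = 0 -> l + l^* < 0.

Lemma eigen_det n (M : 'M[C]_n) l (x : 'rV_n) :
  x != 0 -> x *m M = l *: x -> \det (l%:M - M) = 0.
Proof.
move=> x0 xM; apply/eqP/det0P; exists x => //.
by rewrite mulmxBr xM mul_mx_scalar subrr.
Qed.

Lemma ex_eigen n (M : 'M[C]_n.+1) :
  exists l, exists2 x : 'rV_n.+1, x *m M = l *: x & x != 0.
Proof.
have [l /eigenvalueP [x xl x0]] := eigenvalue_closed M (ltn0Sn n).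
by exists l, x.
Qed.

(* Induction on the dimension.  A left eigenvector [v] of [M] is completed to
   a basis whose other vectors are [p]-orthogonal to [v]; in it [p] is block
   diagonal and [M] block triangular, so the lower blocks satisfy the same
   inequality. *)
Lemma lyapunov n (M p : 'M[C]_n) :
  hstable M -> p^t* = p -> hpsd (- (M *m p + p *m M^t*)) -> hpsd p.
Proof.
elim: n M p => [|n IH] M p sM hp pW.
  by split=> // x; rewrite [x]thinmx0 mul0mx mul0mx mxE.
have [l [v vM v0]] := ex_eigen M.
have lneg : l + l^* < 0 by apply: sM; apply: eigen_det vM.
set W := - _ in pW.
have vMt : M^t* *m v^t* = l^* *: v^t* by rewrite -ct_mul vM ctZ.
have vWv : (v *m W *m v^t*) 0 0 = - (l + l^*) * (v *m p *m v^t*) 0 0.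
  rewrite /W mulmxN mulNmx mulmxDr mulmxDl !mulmxA vM -!mulmxA vMt.
  by rewrite -scalemxAl -!scalemxAr -scalerDl -scaleNr [LHS]mxE.
have a0 : 0 <= (v *m p *m v^t*) 0 0.
  by have := pW.2 v; rewrite vWv pmulr_rge0 // oppr_gt0.
(* If the form vanishes at [v], then [v *m W = 0], so a nonzero [v *m p] would be an eigenvector of
   [M^t*] for [- l]. Then [- l^*] would be an eigenvalue of [M] with positive real part. *)
have pv : v *m (p *m v^t*) = 0 -> p *m v^t* = 0.
  rewrite mulmxA => pv0.
  have vW : v *m W = 0 by apply: (hpsd_ker pW); rewrite vWv pv0 mxE mulr0.
  have E : (v *m p) *m M^t* = - l *: (v *m p).
    move/eqP: vW; rewrite /W mulmxN oppr_eq0 mulmxDr !mulmxA vM addrC addr_eq0.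
    by move=> /eqP->; rewrite scaleNr -scalemxAl.
  have [vp0|vp0] := eqVneq (v *m p) 0.
    by rewrite -[p]hp -ct_mul vp0 ct0.
  have := eigen_det vp0 E => d0.
  have : \det ((- l^*)%:M - M) = 0.
    rewrite -det_tr; apply: (inv_inj (@conjCK C)); rewrite conjC0 -det_map_mx -[RHS]d0.
    congr (\det _); rewrite linearB /= map_mxB; congr (_ - _).
    by rewrite tr_scalar_mx map_scalar_mx rmorphN /= conjCK.
  move/sM; rewrite rmorphN /= conjCK -opprD oppr_lt0 => /(lt_trans lneg).
  by rewrite addrC ltxx.
have [Y [uG Yc]] := adapted_basis (n := n) v0 pv.
set G := col_mx v Y in uG.
pose N := Y *m M *m invmx G.
pose t := lsubmx N; pose T := rsubmx N.
have YM : Y *m M = t *m v + T *m Y.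
  by rewrite -mul_row_col hsubmxK /N mulmxKV.
have GM : G *m M = block_mx l%:M 0 t T *m G.
  by rewrite mul_block_col mul_scalar_mx mul0mx addr0 -YM -vM mul_col_mx.
have sT : hstable T.
  move=> x dx; apply: sM.
  have : \det (G *m (x%:M - M)) = 0.
    rewrite mulmxBr GM scalar_mxC -mulmxBl det_mulmx scalar_mx_block.
    by rewrite opp_block_mx add_block_mx subr0 det_lblock dx mulr0 mul0r.
  rewrite det_mulmx => /eqP; rewrite mulf_eq0 => /orP[|/eqP //].
  by move: uG; rewrite unitmxE unitfE => /negbTE ->.
have vpY : v *m p *m Y^t* = 0.
  by rewrite -hp -[v]trmxCK -!ct_mul mulmxA -mulmxA Yc ct0.
pose p2 := Y *m p *m Y^t*.
have p2p : hpsd p2.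
  apply: (IH T); first exact: sT.
    by rewrite /p2 !ct_mul trmxCK hp mulmxA.
  have -> : - (T *m p2 + p2 *m T^t*) = Y *m W *m Y^t*.
    rewrite /W mulmxN mulNmx; congr (- _).
    rewrite mulmxDr mulmxDl !mulmxA YM.
    have -> : Y *m p *m M^t* *m Y^t* = Y *m p *m (Y *m M)^t*.
      by rewrite ct_mul !mulmxA.
    rewrite YM ctD !ct_mul !mulmxDl mulmxDr.
    rewrite -(mulmxA t v) -(mulmxA t (v *m p)) vpY mulmx0 add0r.
    rewrite (mulmxA (Y *m p) (v^t*)) -(mulmxA Y p (v^t*)) Yc mul0mx add0r.
    by rewrite /p2 !mulmxA.
  exact: hpsd_congr.
split=> // x.
have -> : x = x *m invmx G *m G by rewrite mulmxKV.
rewrite -[x *m invmx G]hsubmxK; set y1 := lsubmx _; set y2 := rsubmx _.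
rewrite mul_row_col ctD !ct_mul mulmxDl !mulmxDr !mulmxDl.
have E1 : y2 *m Y *m p *m (v^t* *m y1^t*) = 0.
  by rewrite mulmxA -(mulmxA _ p (v^t*)) -(mulmxA y2 Y) Yc mulmx0 mul0mx.
have E2 : y1 *m v *m p *m (Y^t* *m y2^t*) = 0.
  by rewrite mulmxA -(mulmxA y1 v) -(mulmxA y1 (v *m p)) vpY mulmx0 mul0mx.
rewrite E1 E2 add0r addr0 mxE addr_ge0 //.
  rewrite [y1]mx11_scalar.
  set c := y1 0 0.
  rewrite mul_scalar_mx -!scalemxAl tr_scalar_mx map_scalar_mx mul_mx_scalar.
  by rewrite -scalemxAr scalerA mxE mulr_ge0 // mul_conjC_ge0.
by have := p2p.2 y2; rewrite /p2 !mulmxA.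
Qed.
End Hermitian.

(** * Real matrices seen as complex ones, and stable pencils *)

Section RealToComplex.
Variable R : realType.
Notation C := R[i].

Lemma toCE m n (M : 'M[R]_(m, n)) : toC M = map_mx (real_complex R) M.
Proof. by []. Qed.

Lemma toC_mul m n p (A : 'M[R]_(m, n)) (B : 'M[R]_(n, p)) :
  toC (A *m B) = toC A *m toC B.
Proof. by rewrite !toCE map_mxM. Qed.

Lemma toC_add m n (A B : 'M[R]_(m, n)) : toC (A + B) = toC A + toC B.
Proof. by rewrite !toCE map_mxD. Qed.

Lemma toC_opp m n (A : 'M[R]_(m, n)) : toC (- A) = - toC A.
Proof. by rewrite !toCE map_mxN. Qed.

Lemma toC_tr m n (A : 'M[R]_(m, n)) : toC A^T = (toC A)^T.
Proof. by rewrite !toCE map_trmx. Qed.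

Lemma toC0 m n : toC (0 : 'M[R]_(m, n)) = 0.
Proof. by rewrite toCE map_mx0. Qed.

Lemma toC1 n : toC (1%:M : 'M[R]_n) = 1%:M.
Proof. by rewrite toCE map_mx1. Qed.

Lemma toC_inj m n : injective (@toC R m n).
Proof.
by move=> A B /matrixP E; apply/matrixP=> i j; have := E i j; rewrite !mxE; case.
Qed.

Lemma det_toC n (A : 'M[R]_n) : \det (toC A) = real_complex R (\det A).
Proof. by rewrite toCE det_map_mx. Qed.

Lemma toC_unit n (A : 'M[R]_n) : (toC A \in unitmx) = (A \in unitmx).
Proof. by rewrite toCE map_unitmx. Qed.

Lemma toC_ct m n (A : 'M[R]_(m, n)) : (toC A)^t* = toC A^T.
Proof.
apply/matrixP=> i j; rewrite !mxE; apply/eqP.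
by rewrite eq_complex /= oppr0 !eqxx.
Qed.

(** Split [x] into real and imaginary parts [a] and [b]: the symmetry of [M] cancels the mixed terms
    and leaves the sum of the real forms at [a] and [b]. *)
Lemma psd_hpsd n (M : 'M[R]_n) : psd M <-> hpsd (toC M).
Proof.
have real0 (A : 'M[R]_1) : (0 <= (toC A) 0 0) = (0 <= A 0 0).
  by rewrite mxE lecE /= eqxx.
split=> -[hM pM]; split.
- by rewrite toC_ct hM.
- move=> x; pose a := map_mx (@complex.Re R) x; pose b := map_mx (@complex.Im R) x.
  have -> : x = toC a + 'i%C *: toC b.
    by apply/matrixP=> i j; rewrite !mxE -complexE.
  rewrite ctD ctZ !toC_ct mulmxDl !mulmxDr !mulmxDl -!scalemxAl -!scalemxAr.
  rewrite -!toC_mul.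
  have -> : b *m M *m a^T = a *m M *m b^T.
    have -> : a *m M *m b^T = (b *m M *m a^T)^T.
      by rewrite !trmx_mul trmxK hM mulmxA.
    by rewrite [LHS]mx11_scalar [RHS]mx11_scalar [in RHS]mxE.
  have -> : ('i%C)^* = - 'i%C :> C by apply/eqP; rewrite eq_complex /= oppr0 !eqxx.
  rewrite scalerA mulrN -expr2 sqr_i opprK scale1r scaleNr.
  rewrite !addrA addrK -toC_add real0 mxE.
  have := pM b^T; have := pM a^T; rewrite !trmxK; exact: addr_ge0.
- by apply: toC_inj; rewrite -toC_ct.
- by move=> x; have := pM (toC x^T); rewrite toC_ct trmxK -!toC_mul real0.
Qed.

Lemma psd_congr m n (M : 'M[R]_n) (G : 'M[R]_(m, n)) :
  psd M -> psd (G *m M *m G^T).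
Proof.
by rewrite !psd_hpsd !toC_mul -toC_ct; apply: hpsd_congr.
Qed.

Lemma psd_add n (M N : 'M[R]_n) : psd M -> psd N -> psd (M + N).
Proof.
move=> [hM pM] [hN pN]; split=> [|x]; first by rewrite linearD /= hM hN.
by rewrite mulmxDr mulmxDl mxE addr_ge0.
Qed.

Lemma psd0 n : psd (0 : 'M[R]_n).
Proof. by split=> [|x]; rewrite ?trmx0 // mulmx0 mul0mx mxE. Qed.

Lemma psd1 n : psd (1%:M : 'M[R]_n).
Proof.
split=> [|x]; first by rewrite trmx1.
by rewrite mulmx1 mxE sumr_ge0 // => i _; rewrite mxE -expr2 sqr_ge0.
Qed.

Lemma psd_gram m n (G : 'M[R]_(m, n)) : psd (G *m G^T).
Proof. by have := psd_congr G (psd1 n); rewrite mulmx1. Qed.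

Lemma psd_ker n (M : 'M[R]_n) (x : 'cV[R]_n) :
  psd M -> (x^T *m M *m x) 0 0 = 0 -> M *m x = 0.
Proof.
move=> pM x0; have [hM _] := pM.
suff : x^T *m M = 0.
  by move=> E; rewrite -[M]hM -[LHS]trmxK trmx_mul trmxK E trmx0.
apply: toC_inj; rewrite toC_mul toC0; apply: hpsd_ker; first exact/psd_hpsd.
by rewrite toC_ct trmxK -!toC_mul mxE x0.
Qed.

Definition stable n (M : 'M[R]_n) :=
  forall l : C, \det (l%:M - toC M) = 0 -> complex.Re l < 0.

Lemma addJ_Re (l : C) : l + l^* = real_complex R (2 * complex.Re l).
Proof.
by apply/eqP; rewrite eq_complex; case: l => a b /=; rewrite subrr eqxx andbT mulr2n mulrDl mul1r.
Qed.

Lemma stable_hstable n (M : 'M[R]_n) : stable M -> hstable (toC M).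
Proof.
move=> sM l /sM lneg; rewrite addJ_Re ltcE /= eqxx /=.
by rewrite pmulr_rlt0 // ltr0n.
Qed.

Lemma stable_tr n (M : 'M[R]_n) : stable M -> stable M^T.
Proof.
move=> sM l dl; apply: sM; rewrite -[RHS]dl -[LHS]det_tr linearB /=.
by rewrite tr_scalar_mx toC_tr.
Qed.

Lemma real_lyapunov n (M p : 'M[R]_n) :
  stable M -> p^T = p -> psd (- (M *m p + p *m M^T)) -> psd p.
Proof.
move=> sM hp /psd_hpsd H; apply/psd_hpsd.
apply: (lyapunov (stable_hstable sM)); first by rewrite toC_ct hp.
by rewrite toC_ct -!toC_mul -toC_add -toC_opp.
Qed.

(** Trades the pencil for an ordinary stable matrix. [V] is built from the Weierstrass form so that
    its columns span the finite deflating subspace, and [W] recovers [E] from its action there. All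
    matrices stay of size [n], so [K] also needs a stable block on the complement. *)
Lemma stable_realization n (E A : 'M[R]_n) : stable_pencil E A ->
  exists V W K : 'M[R]_n, [/\ A *m V = E *m V *m K, E *m V *m W = E & stable K].
Proof.
move=> [_ [P [Z [m [uP [uZ [PEZ PAZ]]]]]] stab].
set N := pid_diag R n m in PEZ.
set K := P *m A *m Z in PAZ.
have KE : K = P *m A *m Z by [].
clearbody K.
have NN : N *m N = N.
  rewrite /N /pid_diag mulmx_diag; congr diag_mx; apply/rowP=> j.
  by rewrite !mxE; case: ifP; rewrite ?mulr1 ?mulr0.
have Nij (i j : 'I_n) : N i j = ((i == j) && (i < m)%N)%:R.
  by rewrite /N !mxE; case: eqVneq => [->|_] //=; case: ltnP.
have NKl i j : (N *m K) i j = if (i < m)%N then K i j else 0.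
  by rewrite /N /pid_diag mul_diag_mx !mxE; case: ifP; rewrite ?mul1r ?mul0r.
have NKr i j : (K *m N) i j = if (j < m)%N then K i j else 0.
  by rewrite /N /pid_diag mul_mx_diag !mxE; case: ifP; rewrite ?mulr1 ?mulr0.
have NK : N *m K = K *m N.
  apply/matrixP=> i j; rewrite NKl NKr.
  case: (ltnP i m) => im; case: (ltnP j m) => jm //.
    rewrite PAZ; last by right.
    by case: eqVneq => // ij; move: im; rewrite ij ltnNge jm.
  rewrite PAZ; last by left.
  by case: eqVneq => // ij; move: jm; rewrite -ij ltnNge im.
have K1N : K - N *m K = 1%:M - N.
  have mxB (A1 A2 : 'M[R]_n) i j : (A1 - A2) i j = A1 i j - A2 i j.
    by rewrite !mxE.
  apply/matrixP=> i j; rewrite !mxB NKl Nij [1%:M i j]mxE.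
  case: (ltnP i m) => im; rewrite ?andbT ?andbF ?subrr // !subr0.
  by rewrite PAZ //; left.
(* [K] is [diag(J, I)], and the unit block has to be made stable. *)
pose L := K *m (N + N - 1%:M).
have NL : N *m L = N *m K.
  by rewrite /L mulmxA NK -!mulmxA (mulmxBr N) (mulmxDr N) NN mulmx1 addrK.
have LE : L = K *m (N + N - 1%:M) by [].
clearbody L.
exists (Z *m N), (invmx Z), L.
have EZ : E *m Z = invmx P *m N by rewrite -PEZ -mulmxA mulKmx.
have AZ : A *m Z = invmx P *m K by rewrite KE -!mulmxA mulKmx.
split.
- rewrite (mulmxA A) (mulmxA E) EZ AZ -(mulmxA _ K N) -(mulmxA _ N N) NN.
  by rewrite -(mulmxA _ N L) NL NK.
- by rewrite (mulmxA E) EZ -(mulmxA _ N N) NN -EZ mulmxK.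
move=> l /eqP/det0P [x x0].
rewrite mulmxBr mul_mx_scalar => /eqP; rewrite subr_eq0 => /eqP/esym xL.
have LN : L *m N = N *m K.
  by rewrite LE -mulmxA mulmxBl mulmxDl NN mul1mx addrK NK.
(* A left eigenvector of [L] either lives on the complement, where [L] is minus the identity, or
   projects to an eigenvector of the finite part of the pencil. *)
have [xN|xN] := eqVneq (x *m toC N) 0.
  have xK : x *m toC K = x.
    have := congr1 (fun A => x *m toC A) K1N.
    rewrite !(toC_add, toC_opp, toC_mul, mulmxBr) mulmxA xN mul0mx !subr0.
    by rewrite toC1 mulmx1.
  have : l *: x = (- 1) *: x.
    rewrite -xL LE toC_mul mulmxA xK !(toC_add, toC_opp) mulmxBr mulmxDr xN.
    by rewrite toC1 mulmx1 addr0 sub0r scaleN1r.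
  move/eqP; rewrite -subr_eq0 -scalerBl scaler_eq0 (negbTE x0) orbF subr_eq0.
  by move=> /eqP->; rewrite /= ltrN10.
apply: stab; have : \det (l *: toC N - toC K) = 0.
  apply/eqP/det0P; exists (x *m toC N) => //.
  rewrite mulmxBr -scalemxAr -!mulmxA -!toC_mul NN -LN toC_mul mulmxA.
  by rewrite xL -scalemxAl subrr.
rewrite -PEZ KE !toC_mul -!mulmxA scalemxAr -mulmxBr scalemxAl -mulmxBl.
rewrite !det_mulmx => /eqP; rewrite !mulf_eq0 => /or3P[|/eqP //|].
  by move: uP; rewrite -toC_unit unitmxE unitfE => /negbTE ->.
by move: uZ; rewrite -toC_unit unitmxE unitfE => /negbTE ->.
Qed.

End RealToComplex.

(* By Cayley-Hamilton [H] is killed by a product of factors [K - z%:M]; each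
   [H *m (K - z%:M)] solves the same equation, and [H *m K = z *: H] forces
   [(A + z *: E) *m H = 0]. *)
Lemma pencil_sylvester (F : closedFieldType) n (A E H K : 'M[F]_n) :
  (forall l, \det (l%:M - K) = 0 -> \det (l *: E + A) != 0) ->
  A *m H + E *m H *m K = 0 -> H = 0.
Proof.
case: n A E H K => [|n] A E H K disj; first by move=> _; rewrite [H]flatmx0.
have [rs rsE] := closed_field_poly_normal (char_poly K).
rewrite (monicP (char_poly_monic K)) scale1r in rsE.
have rsP z : z \in rs -> \det (z%:M - K) = 0.
  move=> zrs; have : root (char_poly K) z.
    by rewrite rsE root_prod_XsubC.
  rewrite -eigenvalue_root_char => /eigenvalueP [v vK v0].
  by apply/eqP/det0P; exists v; rewrite // mulmxBr vK mul_mx_scalar subrr.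
have HrsK : H *m horner_mx K (\prod_(z <- rs) ('X - z%:P)) = 0.
  by rewrite -rsE Cayley_Hamilton mulmx0.
elim: rs H {rsE} rsP HrsK => [|z rs IH] H rsP.
  by rewrite big_nil rmorph1 mulmx1.
rewrite big_cons rmorphM /= rmorphB /= horner_mx_X horner_mx_C mulmxA => H0 HE.
have Hz : H *m (K - z%:M) = 0.
  apply: IH => // [y yrs|]; first by apply: rsP; rewrite in_cons yrs orbT.
  rewrite mulmxA (mulmxA E) -[_ *m K]mulmxA.
  have -> : (K - z%:M) *m K = K *m (K - z%:M).
    by rewrite mulmxBl mulmxBr scalar_mxC.
  by rewrite mulmxA -mulmxDl HE mul0mx.
have /disj := rsP z (mem_head _ _) => uz.
have HK : H *m K = z *: H.
  by move/eqP: Hz; rewrite mulmxBr mul_mx_scalar subr_eq0 => /eqP.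
have : (z *: E + A) *m H = 0.
  by rewrite mulmxDl -scalemxAl -HE -mulmxA HK -scalemxAr addrC.
move=> /(congr1 (mulmx (invmx (z *: E + A)))); rewrite mulKmx ?mulmx0 //.
by rewrite unitmxE unitfE.
Qed.

(** * Generalized Riccati equations: invariance, positivity, uniqueness *)

Section GARE.
Variable R : realType.
Implicit Types n m : nat.

(** Common form of both equations. (GC) has G = B B^T and W = C^T C; (GF) is reached by transposing
    [E], [A] and the solution, with G = C^T C and W = B B^T + 2R. *)
Definition gare n (E A G W P : 'M[R]_n) :=
  [/\ A^T *m P + P^T *m A - P^T *m G *m P + W = 0, E^T *m P = P^T *m E
    & stable_pencil E (A - G *m P)].

Lemma stable_pencil_tr n (E A : 'M[R]_n) :
  stable_pencil E A -> stable_pencil E^T A^T.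
Proof.
have dE (l : R[i]) : \det (l *: toC E^T - toC A^T) = \det (l *: toC E - toC A).
  by rewrite -[RHS]det_tr linearB linearZ /= !toC_tr.
move=> [[s ds] [P [Z [m [uP [uZ [PEZ PAZ]]]]]] st]; split.
- by exists s; rewrite dE.
- exists Z^T, P^T, m; rewrite !unitmx_tr; do 2 split=> //; split.
    by rewrite -mulmxA -!trmx_mul PEZ tr_diag_mx.
  move=> i j ij; rewrite -mulmxA -!trmx_mul mxE PAZ 1?eq_sym //.
  by case: ij; [right | left].
- by move=> l; rewrite dE; apply: st.
Qed.

Lemma stable_pencil_congr n (S T E A : 'M[R]_n) : S \in unitmx -> T \in unitmx ->
  stable_pencil E A -> stable_pencil (S *m E *m T) (S *m A *m T).
Proof.
move=> uS uT.
have dE (l : R[i]) : \det (l *: toC (S *m E *m T) - toC (S *m A *m T)) =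
    \det (toC S) * \det (l *: toC E - toC A) * \det (toC T).
  by rewrite -!det_mulmx !toC_mul mulmxBr mulmxBl -scalemxAr -scalemxAl.
have nS : \det (toC S) != 0 by rewrite -unitfE -unitmxE toC_unit.
have nT : \det (toC T) != 0 by rewrite -unitfE -unitmxE toC_unit.
move=> [[s ds] [P [Z [m [uP [uZ [PEZ PAZ]]]]]] st]; split.
- by exists s; rewrite dE !mulf_neq0.
- have cancel M : P *m invmx S *m (S *m M *m T) *m (invmx T *m Z) = P *m M *m Z.
    by rewrite -!mulmxA (mulKVmx uT) (mulKmx uS).
  exists (P *m invmx S), (invmx T *m Z), m.
  rewrite !unitmx_mul !unitmx_inv uP uS uT uZ; do 2 split=> //.
  by rewrite !cancel; split.
- move=> l; rewrite dE => /eqP; rewrite !mulf_eq0 (negbTE nS) (negbTE nT) orbF /=.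
  by move/eqP/st.
Qed.

(** Pulls solutions of a transformed equation back, so that all comparisons take place in the
    original coordinates. *)
Lemma gare_congr n (S T E A G W P : 'M[R]_n) : S \in unitmx -> T \in unitmx ->
  gare (S *m E *m invmx T) (S *m A *m invmx T) (S *m G *m S^T)
       ((invmx T)^T *m W *m invmx T) P ->
  gare E A G W (S^T *m P *m T).
Proof.
move=> uS uT [eq1 eq2 /(stable_pencil_congr (S := invmx S) (T := T))].
rewrite unitmx_inv => /(_ uS uT) st.
have E1 M : T^T *m ((invmx T)^T *m M *m invmx T) *m T = M.
  by rewrite -!mulmxA mulVmx // mulmx1 mulmxA -trmx_mul mulVmx // trmx1 mul1mx.
split.
- have := congr1 (fun M => T^T *m M *m T) eq1.
  rewrite mulmx0 mul0mx => <-.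
  rewrite mulmxDr mulmxBr mulmxDr !(mulmxDl, mulmxBl) mulNmx E1.
  rewrite !trmx_mul trmxK !mulmxA !(mulmxKV uT).
  by rewrite -[T^T *m (invmx T)^T]trmx_mul mulVmx // trmx1 mul1mx.
- have := congr1 (fun M => T^T *m M *m T) eq2.
  rewrite !trmx_mul trmxK !mulmxA !(mulmxKV uT).
  by rewrite -[T^T *m (invmx T)^T]trmx_mul mulVmx // trmx1 mul1mx.
- by move: st; rewrite mulmxBr mulmxBl !mulmxA mulVmx // !mul1mx !(mulmxKV uT).
Qed.

(** With F = A - G P the equation reads F^T P + P^T F = -(P^T G P + W). Restricted to the columns of
    [V] it is a Lyapunov equation for [p] with the stable [K], and E V Y = E gives E^T P = Y^T p
    Y. *)
Lemma gare_psd n (E A G W P : 'M[R]_n) :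
  psd G -> psd W -> gare E A G W P -> psd (E^T *m P).
Proof.
move=> pG pW [eq1 eq2 /stable_realization [V [Y [K [AV EVY sK]]]]].
have hEP : (E^T *m P)^T = E^T *m P by rewrite trmx_mul trmxK eq2.
pose p := V^T *m (E^T *m P) *m V.
have pp : psd p.
  apply: (real_lyapunov (stable_tr sK)).
    by rewrite /p trmx_mul [(V^T *m _)^T]trmx_mul hEP trmxK mulmxA.
  have H1 : K^T *m p = V^T *m (A - G *m P)^T *m P *m V.
    by rewrite -trmx_mul AV !trmx_mul /p !mulmxA.
  have H2 : p *m K = V^T *m P^T *m (A - G *m P) *m V.
    by rewrite /p eq2 -!mulmxA (mulmxA E) -AV.
  rewrite trmxK H1 H2.
  have -> : - (V^T *m (A - G *m P)^T *m P *m V + V^T *m P^T *m (A - G *m P) *m V)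
     = V^T *m (P^T *m G *m P + W) *m V.
    rewrite -(mulmxA V^T _ P) -(mulmxA V^T P^T) -mulmxDl -mulmxDr -mulNmx -mulmxN.
    congr (_ *m _ *m _).
    rewrite [(A - _)^T]linearB /= trmx_mul pG.1 mulmxBl mulmxBr !mulmxA.
    move: eq1; move: (A^T *m P) (P^T *m A) (P^T *m G *m P) => a b c eq1.
    apply/matrixP=> i j; have := congr1 (fun M : 'M_n => M i j) eq1.
    by rewrite !mxE; lra.
  rewrite -{2}[V]trmxK; apply: psd_congr; apply: psd_add => //.
  by rewrite -{2}[P]trmxK; apply: psd_congr.
have XVY : E^T *m P *m V *m Y = E^T *m P.
  by rewrite eq2 -!mulmxA (mulmxA E) EVY.
have -> : E^T *m P = Y^T *m p *m Y^T^T.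
  have YVX : Y^T *m (V^T *m (E^T *m P)) = E^T *m P.
    move: (E^T *m P) hEP XVY => X hX XVX.
    by rewrite -[in RHS]hX -[in RHS]XVX !trmx_mul hX.
  by rewrite trmxK /p (mulmxA Y^T) YVX XVY.
exact: psd_congr.
Qed.

(** The difference D satisfies (A - G P1)^T D + D^T (A - G P2) = 0; on the columns of [V] this is a
    Sylvester equation with the stable [K], so D V = 0. The spectral condition on [P1] is the one
    that the dissipative closed loop of Q^-1 provides. *)
Lemma gare_unique n (E A G W P1 P2 : 'M[R]_n) : G^T = G ->
  A^T *m P1 + P1^T *m A - P1^T *m G *m P1 + W = 0 -> E^T *m P1 = P1^T *m E ->
  (forall s : R[i], 0 < complex.Re s ->
     \det (s *: toC E - toC (A - G *m P1)) != 0) ->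
  gare E A G W P2 -> E^T *m P1 = E^T *m P2.
Proof.
move=> hG eq1 sym1 reg1 [eq2 sym2 /stable_realization [V [Y [K [AV EVY sK]]]]].
pose D := P1 - P2.
have symD : E^T *m D = D^T *m E.
  by rewrite mulmxBr sym1 sym2 -mulmxBl -linearB.
have eqD : (A - G *m P1)^T *m D + D^T *m (A - G *m P2) = 0.
  rewrite /D ![(_ - _)^T]linearB /= trmx_mul hG !(mulmxBl, mulmxBr) !mulmxA.
  move: eq1 eq2; move: (A^T *m P1) (P1^T *m A) (P1^T *m G *m P1) => a b c eq1.
  move: (A^T *m P2) (P2^T *m A) (P2^T *m G *m P2) (P1^T *m G *m P2) => x y z t eq2.
  apply/matrixP=> i j; have := congr1 (fun M : 'M_n => M i j) eq1.
  have := congr1 (fun M : 'M_n => M i j) eq2; rewrite !mxE; lra.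
have HD : D *m V = 0.
  apply: toC_inj; rewrite toC0.
  apply: (@pencil_sylvester _ _ (toC (A - G *m P1)^T) (toC E^T) _ (toC K)).
    (* l E^T + F^T is the negative of (-l) E^T - F^T with F = A - G P1, and -l has positive real
       part, so [reg1] applies. *)
    move=> l /sK lneg; rewrite -[l]opprK scaleNr addrC -opprB -scaleN1r detZ.
    rewrite mulf_neq0 ?expf_neq0 ?oppr_eq0 ?oner_eq0 //.
    rewrite !toC_tr -linearZ -linearB /= det_tr reg1 //.
    by case: l lneg => a b /=; rewrite oppr_gt0.
  rewrite -!toC_mul -toC_add.
  have -> : E^T *m (D *m V) *m K = D^T *m (A - G *m P2) *m V.
    by rewrite mulmxA symD -!mulmxA (mulmxA E) -AV !mulmxA.
  by rewrite mulmxA -mulmxDl eqD mul0mx toC0.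
apply/eqP; rewrite -subr_eq0 -mulmxBr -/D symD -EVY !mulmxA -symD.
by rewrite -(mulmxA _ D) HD mulmx0 mul0mx.
Qed.

End GARE.

(** * Simultaneous diagonalization of two semidefinite matrices *)

Section Balance.
Variable R : realType.
Implicit Types n m k : nat.

Lemma psd_ker_mx n p (M : 'M[R]_n) (T : 'M[R]_(n, p)) :
  psd M -> T^T *m M *m T = 0 -> M *m T = 0.
Proof.
move=> pM T0; apply/matrixP=> i j; rewrite [RHS]mxE.
pose d := delta_mx j 0 : 'cV[R]_p.
have : M *m (T *m d) = 0.
  apply: psd_ker => //; rewrite trmx_mul.
  have -> : d^T *m T^T *m M *m (T *m d) = d^T *m (T^T *m M *m T) *m d.
    by rewrite !mulmxA.
  by rewrite T0 mulmx0 mul0mx mxE.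
by rewrite mulmxA -colE => /matrixP/(_ i 0); rewrite !mxE.
Qed.

(** Hence a nilpotent [X *m Y] is zero. The form of [Y] vanishes on X Y T, so Y X Y T = 0; then the
    form of [X] vanishes on Y T. *)
Lemma psd_mul_ker n p (X Y : 'M[R]_n) (T : 'M[R]_(n, p)) : psd X -> psd Y ->
  X *m Y *m (X *m Y *m T) = 0 -> X *m Y *m T = 0.
Proof.
move=> pX pY T0; have [hX _] := pX; have [hY _] := pY.
have YXYT : Y *m (X *m Y *m T) = 0.
  apply: psd_ker_mx => //; rewrite !trmx_mul hX hY.
  by rewrite -!mulmxA in T0 *; rewrite T0 !mulmx0.
rewrite -mulmxA; apply: psd_ker_mx => //.
by rewrite trmx_mul hY -!mulmxA in YXYT *; rewrite YXYT mulmx0.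
Qed.

(** For a left eigenvector [v], the form of [Y] at v X equals [z] times the form of [X] at [v]. Both
    are nonnegative, and the latter vanishes only if v X = 0, which would force [z = 0]. *)
Lemma psd_mul_eigen n (X Y : 'M[R]_n) (z : R[i]) : psd X -> psd Y ->
  \det (z%:M - toC (X *m Y)) = 0 -> z != 0 -> 0 < z.
Proof.
move=> /psd_hpsd pX /psd_hpsd pY /eqP/det0P [v v0].
rewrite toC_mul mulmxBr mul_mx_scalar => /eqP; rewrite subr_eq0 => /eqP/esym vXY z0.
have a0 := pX.2 v; have := pY.2 (v *m toC X).
rewrite ct_mul pX.1 !mulmxA -(mulmxA v) vXY -!scalemxAl mxE.
move: a0; rewrite le_eqVlt => /orP [/eqP/esym /(hpsd_ker pX) vX|a0].
  have /eqP : z *: v = 0 by rewrite -vXY mulmxA vX mul0mx.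
  by rewrite scaler_eq0 (negbTE z0) (negbTE v0).
by rewrite pmulr_lge0 // lt0r z0.
Qed.

(** The order on [R[i]] is partial, so the maximum is taken over real parts. *)
Lemma max_Re (rs : seq R[i]) :
  (forall z, z \in rs -> complex.Re z <= 0) \/
  exists2 z, z \in rs & 0 < complex.Re z /\
    forall y, y \in rs -> complex.Re y <= complex.Re z.
Proof.
elim: rs => [|x rs [IH|[z zrs [z0 zmax]]]]; first by left.
  have [x0|x0] := lerP (complex.Re x) 0.
    by left=> z; rewrite in_cons => /orP [/eqP->|/IH].
  right; exists x; rewrite ?mem_head //; split=> // y.
  by rewrite in_cons => /orP [/eqP->|/IH] // y0; apply: le_trans y0 (ltW x0).
right; have [xz|xz] := lerP (complex.Re x) (complex.Re z).
  exists z; rewrite ?in_cons ?zrs ?orbT //; split=> // y.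
  by rewrite in_cons => /orP [/eqP->|/zmax].
exists x; rewrite ?mem_head //; split=> [|y]; first exact: lt_trans xz.
by rewrite in_cons => /orP [/eqP->|/zmax] // yz; apply: le_trans yz (ltW xz).
Qed.

(** Without a positive eigenvalue all roots of the characteristic polynomial are zero, so [X *m Y]
    is nilpotent by Cayley-Hamilton and therefore zero. Maximality is what later sorts the entries
    of Sigma. *)
Lemma max_eigen n (X Y : 'M[R]_n) : psd X -> psd Y -> X *m Y != 0 ->
  exists2 mu, 0 < mu & (exists2 u : 'cV[R]_n, u != 0 & X *m Y *m u = mu *: u) /\
    forall l (v : 'rV[R]_n), v != 0 -> v *m (X *m Y) = l *: v -> l <= mu.
Proof.
case: n X Y => [|n] X Y pX pY XY0; first by rewrite [_ *m _]flatmx0 eqxx in XY0.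
have [rs rsE] := closed_field_poly_normal (char_poly (toC (X *m Y))).
rewrite (monicP (char_poly_monic _)) scale1r in rsE.
have rsP z : (z \in rs) = (\det (z%:M - toC (X *m Y)) == 0).
  rewrite -root_prod_XsubC -rsE -eigenvalue_root_char.
  apply/eigenvalueP/det0P => -[v]; rewrite ?mulmxBr ?mul_mx_scalar.
    by move=> vE v0; exists v; rewrite // mulmxBr mul_mx_scalar vE subrr.
  by move=> v0 /eqP; rewrite subr_eq0 => /eqP vE; exists v.
have pos z : z \in rs -> z != 0 -> 0 < z by rewrite rsP => /eqP; apply: psd_mul_eigen.
have [rs0|[z zrs [z0 zmax]]] := max_Re rs.
  have {}rs0 z : z \in rs -> z = 0.
    move=> zrs; apply/eqP; apply: contraT => /(pos z zrs).
    by rewrite ltcE /= ltNge rs0 // andbF.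
  have chE : char_poly (toC (X *m Y)) = 'X ^+ size rs.
    rewrite rsE (eq_big_seq (fun=> 'X)) => [|z /rs0 ->]; last by rewrite subr0.
    by rewrite big_const_seq count_predT iter_mulr_1.
  have := Cayley_Hamilton (toC (X *m Y)); rewrite chE rmorphXn /= horner_mx_X.
  have toCX k : toC (X *m Y) ^+ k = toC ((X *m Y) ^+ k).
    by elim: k => [|k IH]; [exact/esym/toC1 | rewrite !exprS IH; apply/esym/toC_mul].
  rewrite toCX -(toC0 R) => /toC_inj XYk; case/negP: XY0; apply/eqP.
  elim: (size rs) XYk => [/eqP|[|k] IH //]; first by rewrite expr0 oner_eq0.
  rewrite exprS exprS => H; apply: IH; rewrite exprS.
  exact: (psd_mul_ker pX pY H).
have zR : z = real_complex R (complex.Re z).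
  have : 0 < z by apply: pos => //; apply: contraTneq z0 => ->; rewrite ltxx.
  by rewrite ltcE => /andP [/eqP /= z1 _]; apply/eqP; rewrite eq_complex /= z1 !eqxx.
exists (complex.Re z) => //; split.
  have : \det ((complex.Re z)%:M - X *m Y)^T = 0.
    have : \det (toC ((complex.Re z)%:M - X *m Y)) = 0.
      apply/eqP; rewrite toC_add toC_opp [toC _%:M]toCE map_scalar_mx /= -zR.
      by rewrite -rsP.
    by rewrite det_tr det_toC => -[].
  move=> /eqP/det0P [v v0 vE]; exists v^T; first by rewrite trmx_eq0.
  move/(congr1 trmx): vE; rewrite trmx_mul trmxK trmx0 mulmxBl mul_scalar_mx.
  by move/eqP; rewrite subr_eq0 => /eqP.
move=> l v v0 vE; apply: (zmax (real_complex R l)).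
rewrite rsP; apply/det0P; exists (toC v).
  by apply: contraNneq v0; rewrite -(toC0 R) => /toC_inj ->.
have -> : (real_complex R l)%:M = toC (l%:M : 'M_n.+1) by rewrite toCE map_scalar_mx.
by rewrite -toC_opp -toC_add -toC_mul mulmxBr vE mul_mx_scalar subrr toC0.
Qed.

Lemma psd_drsubmx n (X : 'M[R]_(1 + n)) a (X' : 'M[R]_n) :
  psd X -> X = block_mx a 0 0 X' -> psd X'.
Proof.
move=> pX XE; have := psd_congr (row_mx 0 1%:M) pX.
rewrite XE mul_row_block tr_row_mx mul_row_col.
by rewrite !(mul0mx, mul1mx, mulmx0, add0r, trmx0, trmx1, mulmx1).
Qed.

(** [X] and [Y] transform like a pair of Gramians under a change of state, so that [X *m Y]
    undergoes a similarity. *)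
Definition balances n (X Y G : 'M[R]_n) k k2 k3 (s s2 s3 : nat -> R) :=
  [/\ G \in unitmx, G *m X *m G^T = diagF n k k2 s s2,
      (invmx G)^T *m Y *m invmx G = diagC n k k2 k3 s s3 & (k + k2 + k3 <= n)%N].

Definition spositive k (s : nat -> R) := forall i, (i < k)%N -> 0 < s i.

Definition scons (x : R) (s : nat -> R) i := if i is i'.+1 then s i' else x.

(** [G] conjugates [X *m Y] to the product of the two diagonals, so its first [k] rows are left
    eigenvectors. *)
Lemma balances_eigen n (X Y G : 'M[R]_n) k k2 k3 s s2 s3 i :
  balances X Y G k k2 k3 s s2 s3 -> (i < k)%N ->
  exists2 v : 'rV[R]_n, v != 0 & v *m (X *m Y) = s i ^+ 2 *: v.
Proof.
move=> [uG GX GY kn] ik.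
have i_n : (i < n)%N by lia.
pose e := delta_mx 0 (Ordinal i_n) : 'rV[R]_n.
have GXYG : G *m (X *m Y) = diagF n k k2 s s2 *m diagC n k k2 k3 s s3 *m G.
  rewrite -GX -GY !mulmxA mulmxKV // -(mulmxA _ G^T) -trmx_mul mulVmx //.
  by rewrite trmx1 mulmx1.
have eDF : e *m diagF n k k2 s s2 = s i *: e.
  by rewrite -rowE /diagF row_diag_mx mxE /= ik.
have eDC : e *m diagC n k k2 k3 s s3 = s i *: e.
  by rewrite -rowE /diagC row_diag_mx mxE /= ik.
exists (e *m G).
  apply: contraTneq isT => eG; have : e = 0 by rewrite -[e](mulmxK uG) eG mul0mx.
  by move=> /matrixP/(_ 0 (Ordinal i_n))/eqP; rewrite !mxE !eqxx oner_eq0.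
by rewrite -mulmxA GXYG !mulmxA eDF -scalemxAl eDC scalerA -expr2 -scalemxAl.
Qed.

Lemma block_diag_mx n (a : R) (d : 'rV[R]_n) :
  block_mx a%:M 0 0 (diag_mx d) = diag_mx (row_mx a%:M d) :> 'M_(1 + n).
Proof. by rewrite diag_mx_row; congr block_mx; apply/matrixP=> i j; rewrite !ord1 !mxE. Qed.

(** One deflation step. [G] has first row [w] and its other rows kill [u], so [u] is the first
    column of the inverse; the two proportionality relations then make the off-diagonal blocks
    vanish. *)
Lemma peel n (X Y : 'M[R]_(1 + n)) (w : 'rV_(1 + n)) (u : 'cV_(1 + n)) x y :
  psd X -> psd Y -> w *m u = 1%:M -> w *m X = x *: u^T -> Y *m u = y *: w^T ->
  exists (G : 'M[R]_(1 + n)) (X' Y' : 'M[R]_n),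
    [/\ G \in unitmx, psd X', psd Y', G *m X *m G^T = block_mx x%:M 0 0 X'
      & (invmx G)^T *m Y *m invmx G = block_mx y%:M 0 0 Y'].
Proof.
move=> pX pY wu wX Yu.
have w0 : w != 0.
  by apply: contraTneq isT => w0; move: wu; rewrite w0 mul0mx => /matrixP/(_ 0 0)/eqP;
    rewrite !mxE eqxx eq_sym oner_eq0.
have [Z [uG Zu]] : exists Z : 'M[R]_(n, 1 + n), col_mx w Z \in unitmx /\ Z *m u = 0.
  apply: adapted_basis => //; rewrite wu => /matrixP/(_ 0 0)/eqP.
  by rewrite !mxE eqxx oner_eq0.
set G := col_mx w Z in uG.
have GX : G *m X *m G^T = block_mx x%:M 0 0 (Z *m X *m Z^T).
  have hX := pX.1.
  have ZXw : Z *m X *m w^T = 0.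
    by rewrite -mulmxA -[X]hX -trmx_mul wX linearZ /= trmxK -scalemxAr Zu scaler0.
  rewrite /G mul_col_mx tr_col_mx mul_col_row ZXw wX -scalemxAl -trmx_mul wu trmx1 scalemx1.
  by rewrite -scalemxAl -trmx_mul Zu trmx0 scaler0.
set F := invmx G.
have Gu : G *m u = col_mx 1%:M 0 by rewrite mul_col_mx wu Zu.
have Fu : u = F *m col_mx 1%:M 0 by rewrite -Gu mulKmx.
have wF : w *m F = row_mx 1%:M 0.
  have : G *m F = 1%:M by rewrite mulmxV.
  rewrite mul_col_mx (@scalar_mx_block _ 1 n) => /(congr1 usubmx).
  by rewrite col_mxKu /block_mx col_mxKu.
have [Y' GY] : exists Y', F^T *m Y *m F = block_mx y%:M 0 0 Y'.
  pose M : 'M[R]_(1 + n) := F^T *m Y *m F.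
  have Ml : lsubmx M = col_mx y%:M 0.
    have -> : lsubmx M = M *m col_mx 1%:M 0.
      by rewrite -{2}[M]hsubmxK mul_row_col mulmx1 mulmx0 addr0.
    rewrite /M -!mulmxA -Fu Yu -scalemxAr -trmx_mul wF tr_row_mx trmx1 trmx0.
    by rewrite scale_col_mx scaler0 scalemx1.
  have hM : M^T = M by rewrite /M !trmx_mul trmxK pY.1 mulmxA.
  have [U [Y' ME]] : exists U Y', M = block_mx y%:M U 0 Y'.
    exists (usubmx (rsubmx M)), (dsubmx (rsubmx M)).
    by rewrite block_mxEh -Ml vsubmxK hsubmxK.
  move: hM; rewrite ME tr_block_mx => /eq_block_mx [_ U0 _ _].
  by exists Y'; rewrite -/M ME -U0 trmx0.
exists G, (Z *m X *m Z^T), Y'; split=> //; first exact: psd_congr.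
by apply: psd_drsubmx GY; have := psd_congr F^T pY; rewrite trmxK.
Qed.

(** The enlarged diagonals enter through equations because the new entry may join Sigma, Sigma2 or
    Sigma3. *)
Lemma balances_block n (X Y G : 'M[R]_(1 + n)) (X' Y' G' : 'M[R]_n) x y
    k k2 k3 s s2 s3 l l2 l3 t t2 t3 :
  G \in unitmx -> G *m X *m G^T = block_mx x%:M 0 0 X' ->
  (invmx G)^T *m Y *m invmx G = block_mx y%:M 0 0 Y' ->
  balances X' Y' G' k k2 k3 s s2 s3 -> (l + l2 + l3 <= n.+1)%N ->
  block_mx x%:M 0 0 (diagF n k k2 s s2) = diagF (1 + n) l l2 t t2 ->
  block_mx y%:M 0 0 (diagC n k k2 k3 s s3) = diagC (1 + n) l l2 l3 t t3 ->
  balances X Y ((block_mx 1%:M 0 0 G' : 'M_(1 + n)) *m G) l l2 l3 t t2 t3.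
Proof.
move=> uG GX GY [uG' GX' GY' kn] ln eF eC.
set D := (block_mx 1%:M 0 0 G' : 'M_(1 + n)).
have DD : D *m (block_mx 1%:M 0 0 (invmx G') : 'M_(1 + n)) = 1%:M.
  rewrite mulmx_block !mulmx0 !mul0mx !mulmx1 !addr0 !add0r mulmxV //.
  by rewrite -scalar_mx_block.
have uD : D \in unitmx by case/mulmx1_unit: DD.
have DV : invmx D = block_mx 1%:M 0 0 (invmx G').
  by rewrite -[RHS](mulKmx uD) DD mulmx1.
split=> //; first by rewrite unitmx_mul uD.
- rewrite trmx_mul -!mulmxA (mulmxA G) (mulmxA (G *m X)) GX -eF -GX' mulmxA.
  rewrite /D tr_block_mx !mulmx_block !(mulmx0, mul0mx, addr0, add0r, mul1mx, trmx0).
  by rewrite trmx1 mulmx1.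
- have -> : invmx (D *m G) = invmx G *m invmx D.
    have uDG : D *m G \in unitmx by rewrite unitmx_mul uD.
    by rewrite -[RHS](mulKmx uDG) -mulmxA (mulKVmx uG) (mulmxV uD) mulmx1.
  rewrite trmx_mul -!mulmxA (mulmxA _ Y) (mulmxA _ (invmx G)) GY -eC -GY' mulmxA.
  rewrite DV tr_block_mx !mulmx_block !(mulmx0, mul0mx, addr0, add0r, mul1mx, trmx0).
  by rewrite trmx1 mul1mx mulmx1.
Qed.

Lemma block_diag_scons n x (f : nat -> R) :
  block_mx x%:M 0 0 (diag_mx (\row_(i < n) f i)) =
  diag_mx (\row_(i < 1 + n) scons x f i).
Proof.
rewrite block_diag_mx; congr diag_mx; apply/rowP=> j; rewrite !mxE.
by case: splitP => i ji; rewrite ji !mxE ?ord1.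
Qed.

Lemma eq_diag_row n (f g : nat -> R) :
  (forall i, (i < n)%N -> f i = g i) ->
  diag_mx (\row_(i < n) f i) = diag_mx (\row_(i < n) g i).
Proof. by move=> fg; congr diag_mx; apply/rowP=> j; rewrite !mxE fg. Qed.

Lemma block_diagF n x k k2 s s2 l l2 t t2 :
  let d k k2 (s s2 : nat -> R) i :=
    if (i < k)%N then s i else if (i < k + k2)%N then s2 (i - k)%N else 0 in
  (forall i, scons x (d k k2 s s2) i = d l l2 t t2 i) ->
  block_mx x%:M 0 0 (diagF n k k2 s s2) = diagF (1 + n) l l2 t t2.
Proof.
move=> d dE; apply: etrans (block_diag_scons n x (d k k2 s s2)) _.
by apply: (@eq_diag_row _ _ (d l l2 t t2)).
Qed.

Lemma block_diagC n x k k2 k3 s s3 l l2 l3 t t3 :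
  let d k k2 k3 (s s3 : nat -> R) i :=
    if (i < k)%N then s i else if (i < k + k2)%N then 0
    else if (i < k + k2 + k3)%N then s3 (i - k - k2)%N else 0 in
  (forall i, scons x (d k k2 k3 s s3) i = d l l2 l3 t t3 i) ->
  block_mx x%:M 0 0 (diagC n k k2 k3 s s3) = diagC (1 + n) l l2 l3 t t3.
Proof.
move=> d dE; apply: etrans (block_diag_scons n x (d k k2 k3 s s3)) _.
by apply: (@eq_diag_row _ _ (d l l2 l3 t t3)).
Qed.

Lemma diagF00 n (s s2 : nat -> R) : diagF n 0 0 s s2 = 0.
Proof.
rewrite /diagF (_ : \row_(i < n) _ = 0) ?linear0 //.
by apply/rowP=> j; rewrite !mxE.
Qed.

Lemma diagC000 n (s s3 : nat -> R) : diagC n 0 0 0 s s3 = 0.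
Proof.
rewrite /diagC (_ : \row_(i < n) _ = 0) ?linear0 //.
by apply/rowP=> j; rewrite !mxE.
Qed.

Lemma spositive_scons k x s : 0 < x -> spositive k s -> spositive k.+1 (scons x s).
Proof. by move=> x0 s0 [|i] //= /s0. Qed.

(** Keeps Sigma empty once the product vanishes, so that an entry put in front lands in Sigma2 or
    Sigma3. *)
Lemma balances_nil n (X Y G : 'M[R]_n) k k2 k3 s s2 s3 :
  balances X Y G k k2 k3 s s2 s3 -> spositive k s -> X *m Y = 0 -> k = 0%N.
Proof.
case: k => // k bal s0 XY0; have [v v0] := balances_eigen bal (ltn0Sn k).
rewrite XY0 mulmx0 => /esym/eqP; rewrite scaler_eq0 (negbTE v0) orbF.
by rewrite expf_eq0 /= gt_eqF // s0.
Qed.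

Lemma balances_nil2 n (Y G : 'M[R]_n) k2 k3 s s2 s3 :
  balances 0 Y G 0 k2 k3 s s2 s3 -> spositive k2 s2 -> k2 = 0%N.
Proof.
case: k2 => // k2 [_ GX _ kn] p2; have n0 : (0 < n)%N by lia.
move: GX; rewrite mulmx0 mul0mx => /matrixP/(_ (Ordinal n0) (Ordinal n0)).
by rewrite !mxE eqxx /= => /esym/eqP; rewrite gt_eqF ?mulr1n // p2.
Qed.

Lemma psd_nonzero n (M : 'M[R]_n) : psd M -> M != 0 ->
  exists u : 'cV[R]_n, 0 < (u^T *m M *m u) 0 0.
Proof.
move=> pM M0; have [i [j Mij]] : exists i j, M i j != 0.
  have [/existsP [i /existsP [j Mij]]|H] := boolP [exists i, exists j, M i j != 0].
    by exists i, j.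
  case/eqP: M0; apply/matrixP=> i j; apply/eqP; rewrite mxE; apply: contraNT H.
  by move=> Mij; apply/existsP; exists i; apply/existsP; exists j.
exists (delta_mx j 0); rewrite lt0r pM.2 andbT.
apply: contraNneq Mij => /(psd_ker pM); rewrite -colE => /matrixP/(_ i 0).
by rewrite !mxE => ->.
Qed.

(** Induction on the dimension, in the order of the blocks: Sigma while the product is nonzero, then
    Sigma2 while [X] is nonzero, then Sigma3 while [Y] is. *)
Theorem balancing n (X Y : 'M[R]_n) : psd X -> psd Y ->
  exists G k k2 k3 s s2 s3,
    [/\ balances X Y G k k2 k3 s s2 s3,
        forall i j, (i <= j)%N -> (j < k)%N -> s j <= s i,
        spositive k s, spositive k2 s2 & spositive k3 s3].
Proof.
elim: n X Y => [|n IH] X Y pX pY.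
  exists 1%:M, 0%N, 0%N, 0%N, (fun=> 0), (fun=> 0), (fun=> 0); split=> //.
  by split=> //; rewrite ?unitmx1 // [LHS]flatmx0 [RHS]flatmx0.
have [XY0|XY0] := eqVneq (X *m Y) 0; last first.
  have [mu mu0 [[u u0 XYu] mumax]] := max_eigen pX pY XY0.
  pose q := (u^T *m Y *m u) 0 0.
  have q0 : 0 < q.
    rewrite lt0r pY.2 andbT; apply: contraNneq u0 => /(psd_ker pY) Yu.
    move: XYu; rewrite -mulmxA Yu mulmx0 => /esym/eqP.
    by rewrite scaler_eq0 gt_eqF.
  pose sg := Num.sqrt mu; have sg0 : 0 < sg by rewrite sqrtr_gt0.
  have sg2 : sg ^+ 2 = mu by rewrite sqr_sqrtr // ltW.
  (* The scaling gives u1^T Y u1 = sg. With X Y u1 = sg^2 u1 this yields w u1 = 1, w X = sg u1^T and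
     Y u1 = sg w^T, as [peel] requires. *)
  pose c := Num.sqrt (sg / q).
  have c2 : c ^+ 2 = sg / q by rewrite sqr_sqrtr // ltW // divr_gt0.
  pose u1 := c *: u; pose w := sg^-1 *: (Y *m u1)^T.
  have uYu : u1^T *m Y *m u1 = sg%:M.
    rewrite [LHS]mx11_scalar /u1 [(c *: u)^T]linearZ /= -!scalemxAl -scalemxAr scalerA mxE.
    by rewrite -expr2 c2 -/q divfK ?gt_eqF.
  have [G [X' [Y' [uG pX' pY' GX GY]]]] :
      exists (G : 'M[R]_(1 + n)) (X' Y' : 'M[R]_n),
    [/\ G \in unitmx, psd X', psd Y', G *m X *m G^T = block_mx sg%:M 0 0 X'
      & (invmx G)^T *m Y *m invmx G = block_mx sg%:M 0 0 Y'].
    apply: (@peel _ X Y w u1) => //.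
    - rewrite /w trmx_mul pY.1 -scalemxAl uYu scale_scalar_mx mulVf //.
      by rewrite gt_eqF.
    - rewrite /w -scalemxAl -[X]pX.1 -trmx_mul mulmxA /u1 -scalemxAr XYu.
      rewrite -[sg^-1 *: _]linearZ -[sg *: _]linearZ /=; congr trmx.
      rewrite !scalerA -sg2; congr (_ *: _).
      by rewrite -mulrA mulrC -!mulrA mulfV ?gt_eqF // mulr1 mulrC.
    - by rewrite /w [(_ *: _)^T]linearZ /= trmxK scalerA mulfV ?gt_eqF // scale1r.
  have [G' [k [k2 [k3 [s [s2 [s3 [bal srt p p2 p3]]]]]]]] := IH X' Y' pX' pY'.
  have [uG' _ _ kn] := bal.
  have bal' : balances X Y ((block_mx 1%:M 0 0 G' : 'M_(1 + n)) *m G)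
       k.+1 k2 k3 (scons sg s) s2 s3.
    apply: (balances_block uG GX GY bal) => //.
      by apply: block_diagF => -[|i] //=; rewrite ?(subn0, add0n, addSn, ltnS, subSS).
    by apply: block_diagC => -[|i] //=; rewrite ?(subn0, add0n, addSn, ltnS, subSS).
  exists ((block_mx 1%:M 0 0 G' : 'M_(1 + n)) *m G), k.+1, k2, k3, (scons sg s), s2, s3.
  split=> //; last exact: spositive_scons.
  have s'p := spositive_scons sg0 p.
  (* The squares of the later entries are eigenvalues of [X *m Y], hence at most [mu], the square of
     the new first entry. *)
  move=> [|i] [|j] // ij jk; last exact: srt.
  have [v v0 vE] := balances_eigen bal' jk.
  rewrite -(ler_pXn2r (n := 2)) ?nnegrE ?(ltW (s'p _ _)) //= sg2.
  exact: mumax v0 vE.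
have [X0|X0] := eqVneq X 0; last first.
  have [u] := psd_nonzero pX X0; set q := (_ 0 0) => q0.
  have qE : u^T *m X *m u = q%:M by rewrite [LHS]mx11_scalar.
  have [G [X' [Y' [uG pX' pY' GX GY]]]] :
      exists (G : 'M[R]_(1 + n)) (X' Y' : 'M[R]_n),
    [/\ G \in unitmx, psd X', psd Y', G *m X *m G^T = block_mx q%:M 0 0 X'
      & (invmx G)^T *m Y *m invmx G = block_mx 0%:M 0 0 Y'].
    (* The dual vector is proportional to X u, which [Y] kills because Y X is the transpose of X Y =
       0. *)
    apply: (@peel _ X Y u^T (q^-1 *: (X *m u))) => //.
    - by rewrite -scalemxAr mulmxA qE scale_scalar_mx mulVf // gt_eqF.
    - by rewrite linearZ /= scalerA mulfV ?gt_eqF // scale1r trmx_mul pX.1.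
    - rewrite -scalemxAr mulmxA scale0r -[Y]pY.1 -{1}[X]pX.1 -trmx_mul XY0.
      by rewrite trmx0 mul0mx scaler0.
  have XY'0 : X' *m Y' = 0.
    have : G *m X *m G^T *m ((invmx G)^T *m Y *m invmx G) = 0.
      rewrite !mulmxA -(mulmxA _ G^T) -trmx_mul mulVmx // trmx1 mulmx1.
      by rewrite -(mulmxA G) XY0 mulmx0 mul0mx.
    rewrite GX GY mulmx_block -block_mx0 => /eq_block_mx [_ _ _].
    by rewrite mulmx0 add0r.
  have [G' [k [k2 [k3 [s [s2 [s3 [bal srt p p2 p3]]]]]]]] := IH X' Y' pX' pY'.
  have k0 := balances_nil bal p XY'0; subst k.
  have [uG' _ _ kn] := bal.
  exists ((block_mx 1%:M 0 0 G' : 'M_(1 + n)) *m G), 0%N, k2.+1, k3, s, (scons q s2), s3.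
  split=> //; last exact: spositive_scons.
  apply: (balances_block uG GX GY bal) => //.
    by apply: block_diagF => -[|i] //=; rewrite ?(subn0, add0n, addSn, ltnS, subSS).
  by apply: block_diagC => -[|i] //=; rewrite ?(subn0, add0n, addSn, ltnS, subSS).
rewrite {}X0 in pX XY0 *.
have [Y0|Y0] := eqVneq Y 0.
  exists 1%:M, 0%N, 0%N, 0%N, (fun=> 0), (fun=> 0), (fun=> 0); split=> //.
  split; rewrite ?unitmx1 ?diagF00 ?diagC000 ?Y0 ?mulmx0 ?mul0mx //.
have [u] := psd_nonzero pY Y0; set q := (_ 0 0) => q0.
have qE : u^T *m Y *m u = q%:M by rewrite [LHS]mx11_scalar.
have [G [X' [Y' [uG pX' pY' GX GY]]]] :
    exists (G : 'M[R]_(1 + n)) (X' Y' : 'M[R]_n),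
  [/\ G \in unitmx, psd X', psd Y', G *m 0 *m G^T = block_mx 0%:M 0 0 X'
    & (invmx G)^T *m Y *m invmx G = block_mx q%:M 0 0 Y'].
  apply: (@peel _ 0 Y (q^-1 *: (u^T *m Y)) u) => //.
  - by rewrite -scalemxAl qE scale_scalar_mx mulVf // gt_eqF.
  - by rewrite mulmx0 scale0r.
  - by rewrite linearZ /= scalerA mulfV ?gt_eqF // scale1r trmx_mul pY.1 trmxK.
have X'0 : X' = 0.
  by move: GX; rewrite mulmx0 mul0mx -block_mx0 => /eq_block_mx [_ _ _ <-].
rewrite {}X'0 in pX' GX.
have [G' [k [k2 [k3 [s [s2 [s3 [bal srt p p2 p3]]]]]]]] := IH 0 Y' pX' pY'.
have k0 := balances_nil bal p (mul0mx _ _); subst k.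
have k20 := balances_nil2 bal p2; subst k2.
have [uG' _ _ kn] := bal.
exists ((block_mx 1%:M 0 0 G' : 'M_(1 + n)) *m G), 0%N, 0%N, k3.+1, s, s2, (scons q s3).
split=> //; last exact: spositive_scons.
apply: (balances_block uG GX GY bal) => //.
  by apply: block_diagF => -[|i] //=; rewrite ?(subn0, add0n, addSn, ltnS, subSS).
by apply: block_diagC => -[|i] //=; rewrite ?(subn0, add0n, addSn, ltnS, subSS).
Qed.

End Balance.

(** * Semi-explicit coordinates adapted to both matrices *)

Section Coordinates.
Variable R : realType.
Implicit Types n m k r : nat.

Lemma pid_diagE n r : pid_diag R n r = pid_mx r.
Proof.
apply/matrixP=> i j; rewrite !mxE.
by rewrite -val_eqE /=; case: (_ == _ :> nat) => //=; case: ltnP.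
Qed.

Lemma block_diag0 r q (d : 'rV[R]_r) :
  block_mx (diag_mx d) 0 0 0 = diag_mx (row_mx d (0 : 'rV_q)).
Proof. by rewrite diag_mx_row linear0. Qed.

Lemma block_diagF0 r q k k2 s s2 : (k + k2 <= r)%N ->
  block_mx (diagF r k k2 s s2) 0 0 0 = diagF (r + q) k k2 s s2 :> 'M[R]_(r + q).
Proof.
move=> kr; rewrite block_diag0; congr diag_mx; apply/rowP=> j; rewrite !mxE.
case: splitP => i ->; rewrite ?mxE //.
by do 2 (case: ltnP => /= ?; first lia).
Qed.

Lemma block_diagC0 r q k k2 k3 s s3 : (k + k2 + k3 <= r)%N ->
  block_mx (diagC r k k2 k3 s s3) 0 0 0 = diagC (r + q) k k2 k3 s s3
    :> 'M[R]_(r + q).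
Proof.
move=> kr; rewrite block_diag0; congr diag_mx; apply/rowP=> j; rewrite !mxE.
case: splitP => i ->; rewrite ?mxE //.
by do 3 (case: ltnP => /= ?; first lia).
Qed.

(** The factorization clears the last rows, and symmetry then clears the last columns. *)
Lemma psd_pid_block r q (X K : 'M[R]_(r + q)) : psd X -> X = pid_mx r *m K ->
  exists2 X1 : 'M[R]_r, psd X1 & X = block_mx X1 0 0 0.
Proof.
move=> pX XK.
have [K1 [K2 XE]] : exists K1 K2, X = block_mx K1 K2 0 0.
  exists (ulsubmx K), (ursubmx K).
  rewrite XK pid_mx_block -[in LHS](submxK K) mulmx_block.
  by rewrite !mul1mx !mul0mx !addr0.
have := pX.1; rewrite XE tr_block_mx => /eq_block_mx [_ K20 _ _].
rewrite -K20 trmx0 in XE; exists K1; last by rewrite -K20 trmx0.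
have := psd_congr (row_mx 1%:M 0) pX.
rewrite XE mul_row_block tr_row_mx mul_row_col.
by rewrite !(mul0mx, mul1mx, mulmx0, addr0, trmx0, trmx1, mulmx1).
Qed.

(** The balancing matrix of the leading blocks, extended by the identity, commutes with [pid_mx r]
    and so preserves the semi-explicit form. *)
Lemma balanced_pid n r : (r <= n)%N -> forall X Y K L : 'M[R]_n,
  psd X -> psd Y -> X = pid_mx r *m K -> Y = pid_mx r *m L ->
  exists G k k2 k3 s s2 s3,
    [/\ G \in unitmx /\ G *m pid_mx r *m invmx G = pid_mx r,
        G *m X *m G^T = diagF n k k2 s s2,
        (invmx G)^T *m Y *m invmx G = diagC n k k2 k3 s s3 &
        [/\ (k + k2 + k3 <= r)%N,
            forall i j, (i <= j)%N -> (j < k)%N -> s j <= s i,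
            spositive k s, spositive k2 s2 & spositive k3 s3]].
Proof.
move=> rn; rewrite -(subnKC rn); move: (n - r)%N => q X Y K L pX pY.
move=> /(psd_pid_block pX) [X1 pX1 ->] /(psd_pid_block pY) [Y1 pY1 ->].
have [G [k [k2 [k3 [s [s2 [s3 [[uG GX GY kr] srt p p2 p3]]]]]]]] :=
  balancing pX1 pY1.
pose D : 'M[R]_(r + q) := block_mx G 0 0 1%:M.
have DD : D *m block_mx (invmx G) 0 0 1%:M = 1%:M.
  rewrite mulmx_block !mulmx0 !mul0mx !mulmx1 !addr0 !add0r mulmxV //.
  by rewrite -scalar_mx_block.
have uD : D \in unitmx by case/mulmx1_unit: DD.
have DV : invmx D = block_mx (invmx G) 0 0 1%:M.
  by rewrite -[RHS](mulKmx uD) DD mulmx1.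
exists D, k, k2, k3, s, s2, s3; split=> //.
- split=> //; rewrite DV pid_mx_block !mulmx_block.
  by rewrite !(mulmx0, mul0mx, mulmx1, addr0, add0r) mulmxV.
- rewrite -block_diagF0 -?GX; last by lia.
  by rewrite tr_block_mx !mulmx_block !(trmx0, mulmx0, mul0mx, addr0, add0r).
- rewrite -block_diagC0 // -GY DV.
  by rewrite tr_block_mx !mulmx_block !(trmx0, mulmx0, mul0mx, addr0, add0r).
Qed.

(** The rank factorization of [E] first makes it semi-explicit; the same [G] then multiplies both
    [S] and [T]. The factors [K] and [L] confine [X] and [Y] to the first coordinates. *)
Lemma balanced_coordinates n (E X Y K L : 'M[R]_n) :
  psd X -> psd Y -> X = E *m K -> Y = E^T *m L ->
  exists S T k k2 k3 s s2 s3,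
    [/\ [/\ S \in unitmx, T \in unitmx &
            S *m E *m invmx T = pid_diag R n (\rank E)],
        S *m X *m S^T = diagF n k k2 s s2,
        (invmx T)^T *m Y *m invmx T = diagC n k k2 k3 s s3 &
        [/\ (k + k2 + k3 <= \rank E)%N,
            forall i j, (i <= j)%N -> (j < k)%N -> s j <= s i,
            spositive k s, spositive k2 s2 & spositive k3 s3]].
Proof.
move=> pX pY XK YL; set r := \rank E.
pose S := invmx (col_ebase E); pose T := row_ebase E.
have uS : S \in unitmx by rewrite unitmx_inv col_ebase_unit.
have uT : T \in unitmx := row_ebase_unit E.
have SE : S *m E = pid_mx r *m T.
  by rewrite -{1}(mulmx_ebase E) -mulmxA mulKmx ?col_ebase_unit.
have [] := @balanced_pid n r (rank_leq_row E) (S *m X *m S^T)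
  ((invmx T)^T *m Y *m invmx T) (T *m K *m S^T) (invmx S^T *m L *m invmx T).
- exact: psd_congr.
- by have := psd_congr (invmx T)^T pY; rewrite trmxK.
- by rewrite XK !mulmxA SE.
- have -> : pid_mx r = (invmx T)^T *m E^T *m S^T.
    rewrite -trmx_mul -trmx_mul mulmxA SE mulmxK // tr_pid_mx //.
  by rewrite YL !mulmxA mulmxK ?unitmx_tr.
move=> G [k [k2 [k3 [s [s2 [s3 [[uG GN] GX GY H]]]]]]].
have uGT : G *m T \in unitmx by rewrite unitmx_mul uG.
have VGT : invmx (G *m T) = invmx T *m invmx G.
  by rewrite -[RHS](mulKmx uGT) -mulmxA (mulKVmx uT) (mulmxV uG) mulmx1.
exists (G *m S), (G *m T), k, k2, k3, s, s2, s3; split=> //.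
- split=> //; first by rewrite unitmx_mul uG.
  by rewrite VGT -(mulmxA G S) SE -!mulmxA (mulKVmx uT) mulmxA GN pid_diagE.
- by rewrite -GX trmx_mul !mulmxA.
- by rewrite VGT -GY trmx_mul !mulmxA.
Qed.

End Coordinates.

(** * The port-Hamiltonian filter equation and the final assembly *)

Section Main.
Variable R : realType.
Implicit Types n m : nat.

Lemma stab_GC_gare n m (E A P : 'M[R]_n) (B : 'M_(n, m)) (C : 'M_(m, n)) :
  stab_GC E A B C P -> gare E A (B *m B^T) (C^T *m C) P.
Proof. by move=> [eq1 eq2 st]; split; rewrite // mulmxA. Qed.

Lemma stab_GF_gare n m (E A Rd P : 'M[R]_n) (B : 'M_(n, m)) (C : 'M_(m, n)) :
  stab_GF E A Rd B C P ->
  gare E^T A^T (C^T *m C) (B *m B^T + 2%:R *: Rd) P^T.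
Proof.
move=> [eq1 eq2 /stable_pencil_tr st]; split; rewrite ?trmxK //.
  by rewrite -[RHS]eq1 !mulmxA addrA.
by move: st; rewrite linearB /= !trmx_mul !trmxK mulmxA.
Qed.

Lemma conj_add_gt0 (s : R[i]) : 0 < complex.Re s -> 0 < s + s^*.
Proof. by move=> s0; rewrite addJ_Re ltcE /= eqxx /= mulr_gt0 // ltr0n. Qed.

(* [J - Rd - B *m B^T] is dissipative, so an eigenvector for [Re s > 0] would lie
   in the kernel of both [E] and [A]. *)
Lemma pH_closed_loop n m (E J Rd Q : 'M[R]_n) (B : 'M_(n, m)) :
  psd (E^T *m Q) -> J^T = - J -> psd Rd -> Q \in unitmx ->
  regular_pencil E ((J - Rd) *m Q) ->
  forall s : R[i], 0 < complex.Re s ->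
    \det (s *: toC E^T - toC (Q^T *m (- J - Rd - B *m B^T))) != 0.
Proof.
move=> pEQ hJ pR uQ [s0 reg] s /conj_add_gt0 sgt.
apply/eqP => /eqP/det0P [x x0].
rewrite mulmxBr -scalemxAr => /eqP; rewrite subr_eq0 => /eqP xE.
pose y := x *m toC Q^T.
have sE : E^T *m Q = Q^T *m E by rewrite -[LHS]pEQ.1 trmx_mul trmxK.
pose W := Rd + B *m B^T.
have pBB : psd (B *m B^T) by apply: psd_gram.
have pW : hpsd (toC W) by apply/psd_hpsd/psd_add.
have yE : y *m toC (- J - W) = s *: (x *m toC E^T).
  by rewrite xE /y -mulmxA -toC_mul /W opprD addrA.
have yct : toC Q *m x^t* = y^t* by rewrite /y ct_mul toC_ct trmxK.
have yQ : x *m toC Q^T = y by [].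
clearbody y.
pose a := (x *m toC (E^T *m Q) *m x^t*) 0 0.
pose b := (y *m toC W *m y^t*) 0 0.
pose j := (y *m toC J *m y^t*) 0 0.
have a0 : 0 <= a by apply: (proj1 (psd_hpsd _) pEQ).2.
have b0 : 0 <= b by apply: pW.2.
have jJ : j^* = - j.
  have -> : - j = (- (y *m toC J *m y^t*)) 0 0 by rewrite [RHS]mxE.
  have <- : (y *m toC J *m y^t*)^t* = - (y *m toC J *m y^t*).
    by rewrite !ct_mul trmxCK toC_ct hJ toC_opp mulNmx mulmxN mulmxA.
  by rewrite [RHS]mxE [in RHS]mxE.
have sab : s * a = - j - b.
  have : s *: (x *m toC (E^T *m Q) *m x^t*) =
      - (y *m toC J *m y^t*) - y *m toC W *m y^t*.
    rewrite toC_mul mulmxA -(mulmxA _ _ (x^t*)) yct scalemxAl -yE.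
    by rewrite toC_add !toC_opp mulmxBr mulmxN mulmxBl mulNmx.
  have mxNB (M N : 'M[R[i]]_1) : (- M - N) 0 0 = - M 0 0 - N 0 0.
    by rewrite !mxE.
  by move=> /(congr1 (fun M : 'M_1 => M 0 0)); rewrite mxNB [LHS]mxE.
(* Adding the conjugate removes the imaginary number [j]. Since [a] and [b] are nonnegative, both
   must vanish. *)
have sab' : (s + s^*) * a = - (b + b).
  have := congr1 Num.conj sab; rewrite rmorphM rmorphB rmorphN /= jJ opprK.
  rewrite (geC0_conj a0) (geC0_conj b0) => sab2.
  by rewrite mulrDl sab sab2; ring.
have a00 : a = 0.
  apply/eqP; apply: contraT => an0; have ap : 0 < a by rewrite lt0r an0.
  have := mulr_gt0 sgt ap; rewrite sab' oppr_gt0 => bb.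
  by have := lt_le_trans bb (addr_ge0 b0 b0); rewrite ltxx.
have b00 : b = 0.
  move/eqP: sab'; rewrite a00 mulr0 eq_sym oppr_eq0 paddr_eq0 //.
  by case/andP=> /eqP.
have xE0 : x *m toC E^T = 0.
  have := hpsd_ker (proj1 (psd_hpsd _) pEQ) a00; rewrite toC_mul mulmxA.
  move/(congr1 (mulmx^~ (invmx (toC Q)))); rewrite mul0mx mulmxK //.
  by rewrite toC_unit.
have yW : y *m toC W = 0 by apply: (hpsd_ker pW).
have yR : y *m toC Rd = 0.
  apply: (hpsd_ker (proj1 (psd_hpsd _) pR)).
  move/eqP: b00; rewrite /b /W toC_add mulmxDr mulmxDl mxE.
  rewrite paddr_eq0; last 2 first.
  - exact: (proj1 (psd_hpsd _) pR).2.
  - exact: (proj1 (psd_hpsd _) pBB).2.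
  by case/andP=> /eqP.
have yJ : y *m toC J = 0.
  move/eqP: yE; rewrite xE0 scaler0 toC_add !toC_opp mulmxBr yW subr0 mulmxN.
  by rewrite oppr_eq0 => /eqP.
have : \det (s0 *: toC E - toC ((J - Rd) *m Q)) = 0.
  rewrite -det_tr linearB linearZ /= -!toC_tr; apply/eqP/det0P; exists x => //.
  rewrite mulmxBr -scalemxAr xE0 scaler0 sub0r trmx_mul toC_mul mulmxA yQ.
  by rewrite linearB /= hJ pR.1 toC_add !toC_opp mulmxBr mulmxN yJ yR !oppr0 addr0 oppr0.
by move/eqP; rewrite (negbTE reg).
Qed.

(** At Q^-1 the linear terms sum to (J - R) + (J - R)^T = -2R and the quadratic term is B B^T, so
    the transposed filter equation holds. The closed-loop matrix becomes Q^T (-J - R - B B^T), to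
    which [pH_closed_loop] applies. *)
Lemma filter_gramian n m (E J Rd Q : 'M[R]_n) (B : 'M_(n, m)) P :
  psd (E^T *m Q) -> J^T = - J -> psd Rd -> Q \in unitmx ->
  regular_pencil E ((J - Rd) *m Q) ->
  gare E^T ((J - Rd) *m Q)^T ((B^T *m Q)^T *m (B^T *m Q))
    (B *m B^T + 2%:R *: Rd) P ->
  E *m invmx Q = E *m P.
Proof.
move=> pEQ hJ pR uQ reg g.
have sE : E^T *m Q = Q^T *m E by rewrite -[LHS]pEQ.1 trmx_mul trmxK.
have VQ : (invmx Q)^T *m Q^T = 1%:M by rewrite -trmx_mul mulmxV ?trmx1.
have hJR : (J - Rd)^T = - J - Rd by rewrite linearB /= hJ pR.1.
rewrite -[E]trmxK; apply: (gare_unique _ _ _ _ g).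
- by rewrite !trmx_mul !trmxK.
- rewrite trmxK mulmxK // -trmx_mul mulmxK // hJR.
  have -> : (invmx Q)^T *m ((B^T *m Q)^T *m (B^T *m Q)) *m invmx Q = B *m B^T.
    by rewrite trmx_mul trmxK !mulmxA VQ mul1mx mulmxK.
  by move: (B *m B^T) => M; apply/matrixP=> i j; rewrite !mxE; ring.
- have := congr1 (fun M => (invmx Q)^T *m M *m invmx Q) sE.
  by rewrite trmxK !mulmxA mulmxK // VQ mul1mx.
- move=> s /(pH_closed_loop B pEQ hJ pR uQ reg).
  suff -> : ((J - Rd) *m Q)^T - (B^T *m Q)^T *m (B^T *m Q) *m invmx Q =
    Q^T *m (- J - Rd - B *m B^T) by [].
  by rewrite !trmx_mul trmxK hJR !mulmxA mulmxK // -mulmxA -mulmxBr.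
Qed.

Lemma gare_unique_stab n (E A G W P1 P2 : 'M[R]_n) : G^T = G ->
  gare E A G W P1 -> gare E A G W P2 -> E^T *m P1 = E^T *m P2.
Proof.
move=> hG [eq1 eq2 [_ _ st]]; apply: gare_unique eq1 eq2 _ => // s s0.
by apply: contraTneq s0 => /st; rewrite -leNgt => /ltW.
Qed.

(** The diagonal entry of row [i] shows that the factor from [d] is nonzero, so it can be cancelled
    off the diagonal. *)
Lemma pid_diag_mul_diag n r (d : 'rV[R]_n) (M : 'M[R]_n) (i j : 'I_n) :
  pid_diag R n r = diag_mx d *m M -> (i < r)%N -> i != j -> M i j = 0.
Proof.
move=> /matrixP E ir ij; have := E i i; have := E i j.
rewrite !mul_diag_mx !mxE !eqxx (negbTE ij) ir mulr0n mulr1n.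
move=> /esym/eqP; rewrite mulf_eq0 => /orP [/eqP-> /esym/eqP|/eqP //].
by rewrite mul0r eq_sym oner_eq0.
Qed.

Lemma mul_pid_diag_diag n r (d : 'rV[R]_n) (M : 'M[R]_n) (i j : 'I_n) :
  pid_diag R n r *m M = diag_mx d -> (i < r)%N -> i != j -> M i j = 0.
Proof.
move=> /matrixP/(_ i j); rewrite mul_diag_mx !mxE => + ir /negbTE ij.
by rewrite ir ij mul1r mulr0n.
Qed.

End Main.

Theorem mainTheorem6 (R : realType) (n m : nat)
  (E J Rd Q : 'M[R]_n) (B : 'M[R]_(n, m)) :
  psd (E^T *m Q) -> E^T *m Q = Q^T *m E ->
  J^T = - J -> psd Rd ->
  let A := (J - Rd) *m Q in
  let C := B^T *m Q in
  regular_pencil E A ->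
  strongly_stabilizable E A B ->
  strongly_detectable E A C ->
  let r := \rank E in
  exists S T : 'M[R]_n,
    [/\ S \in unitmx, T \in unitmx &
    let Et := S *m E *m invmx T in
    let Jt := S *m J *m S^T in
    let Rt := S *m Rd *m S^T in
    let Qt := (invmx S)^T *m Q *m invmx T in
    let Bt := S *m B in
    let At := (Jt - Rt) *m Qt in
    let Ct := Bt^T *m Qt in
    (* (i) *)
    [/\ Et = pid_diag R n r,
        exists (k k2 k3 : nat) (s s2 s3 : nat -> R),
          [/\ (k + k2 + k3 <= r)%N,
              forall i j : nat, (i <= j)%N -> (j < k)%N -> s j <= s i,
              forall i : nat, (i < k)%N -> 0 < s i,
              (forall i : nat, (i < k2)%N -> 0 < s2 i) /\
                (forall i : nat, (i < k3)%N -> 0 < s3 i) &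
              forall Pc Pf : 'M[R]_n,
                stab_GC Et At Bt Ct Pc -> stab_GF Et At Rt Bt Ct Pf ->
                Pf *m Et^T = diagF n k k2 s s2 /\
                Et^T *m Pc = diagC n k k2 k3 s s3]
    (* (ii) *)
    & Q \in unitmx ->
        forall i j : 'I_n, (i < r)%N ->
          ((r <= j)%N -> Qt i j = 0) /\ ((j < r)%N -> i != j -> Qt i j = 0)]].
Proof.
move=> pEQ _ hJ pR A C reg _ _ r.
have tS (S : 'M[R]_n) : S \in unitmx -> S^T *m (invmx S)^T = 1%:M.
  by move=> uS; rewrite -trmx_mul mulVmx // trmx1.
have AtE (S T : 'M[R]_n) : S \in unitmx ->
    (S *m J *m S^T - S *m Rd *m S^T) *m ((invmx S)^T *m Q *m invmx T) =
    S *m A *m invmx T.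
  by move=> uS; rewrite /A -mulmxBl -mulmxBr !mulmxA -(mulmxA _ S^T) tS ?mulmx1.
have CtE (S T : 'M[R]_n) : S \in unitmx ->
    (S *m B)^T *m ((invmx S)^T *m Q *m invmx T) = C *m invmx T.
  by move=> uS; rewrite /C trmx_mul !mulmxA -(mulmxA _ S^T) tS ?mulmx1.
have gramE P : Q \in unitmx ->
    gare E^T A^T (C^T *m C) (B *m B^T + 2%:R *: Rd) P -> E *m invmx Q = E *m P.
  by move=> uQ; apply: filter_gramian.
clearbody A C.
have backC (S T P : 'M[R]_n) : S \in unitmx -> T \in unitmx ->
    stab_GC (S *m E *m invmx T) (S *m A *m invmx T) (S *m B) (C *m invmx T) P ->
    gare E A (B *m B^T) (C^T *m C) (S^T *m P *m T).
  move=> uS uT /stab_GC_gare g; apply: (gare_congr uS uT).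
  have -> : S *m (B *m B^T) *m S^T = S *m B *m (S *m B)^T.
    by rewrite trmx_mul !mulmxA.
  have -> // : (invmx T)^T *m (C^T *m C) *m invmx T =
    (C *m invmx T)^T *m (C *m invmx T) by rewrite trmx_mul !mulmxA.
have backF (S T P : 'M[R]_n) : S \in unitmx -> T \in unitmx ->
    stab_GF (S *m E *m invmx T) (S *m A *m invmx T) (S *m Rd *m S^T) (S *m B)
      (C *m invmx T) P ->
    gare E^T A^T (C^T *m C) (B *m B^T + 2%:R *: Rd)
      (invmx T *m P^T *m invmx S^T).
  move=> uS uT /stab_GF_gare g.
  (* Transposition turns the change of coordinates (S, T) into (T^-T, S^-T). *)
  have uT' : (invmx T)^T \in unitmx by rewrite unitmx_tr unitmx_inv.
  have uS' : invmx S^T \in unitmx by rewrite unitmx_inv unitmx_tr.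
  rewrite -[invmx T]trmxK; apply: (gare_congr uT' uS').
  move: g; rewrite trmxK invmxK trmxK !trmx_mul !mulmxA mulmxDr mulmxDl !mulmxA.
  by rewrite -scalemxAr -scalemxAl ?trmxK ?mulmxA.
have pBB : psd (B *m B^T) by apply: psd_gram.
have pCC : psd (C^T *m C) by have := psd_gram C^T; rewrite trmxK.
have pW : psd (B *m B^T + 2%:R *: Rd).
  apply: psd_add => //; rewrite scaler_nat mulr2n; exact: psd_add.
(* One pair of stabilizing solutions fixes [S] and [T]; by uniqueness every other pair gives the
   same two matrices. Here [Pf] solves the transposed filter equation, so [E *m Pf] is the matrix to
   diagonalize. *)
have [[[Pc Pf] [/= gC gF]]|none] := pselect (exists PP : 'M[R]_n * 'M[R]_n,
    gare E A (B *m B^T) (C^T *m C) PP.1 /\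
    gare E^T A^T (C^T *m C) (B *m B^T + 2%:R *: Rd) PP.2).
  have pX : psd (E *m Pf) by rewrite -[E]trmxK; apply: gare_psd gF.
  have pY : psd (E^T *m Pc) by apply: gare_psd gC.
  have [S [T [k [k2 [k3 [s [s2 [s3 [[uS uT ET] XT YT [kr srt p p2 p3]]]]]]]]]] :=
    balanced_coordinates pX pY erefl erefl.
  exists S, T; split=> //; cbv zeta; rewrite AtE // CtE //.
  set Qt := (invmx S)^T *m Q *m invmx T; split=> //.
    exists k, k2, k3, s, s2, s3; split=> // Pc' Pf'.
    move=> /(backC _ _ _ uS uT) gC' gF'; have [_ sF _] := gF'.
    have EC := gare_unique_stab pBB.1 gC' gC.
    have EF := gare_unique_stab pCC.1 (backF _ _ _ uS uT gF') gF.
    rewrite trmxK in EF; rewrite -sF -XT -YT -EC -EF; split.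
      rewrite !mulmxA -(mulmxA _ (invmx S^T)) mulVmx ?unitmx_tr //.
      by rewrite mulmx1.
    by rewrite !trmx_mul !mulmxA mulmxK.
  (* E Q^-1 = E Pf makes S E Q^-1 S^T equal to the diagonal [diagF], and its product with [Qt] is S
     E T^-1. *)
  move=> uQ; have QtE : pid_diag R n r = diagF n k k2 s s2 *m Qt.
    rewrite -ET -XT -(gramE _ uQ gF) /Qt !mulmxA -(mulmxA _ S^T) tS // mulmx1.
    by rewrite mulmxKV.
  move=> i j ir; split=> [rj|_ ij]; apply: (pid_diag_mul_diag QtE ir) => //.
  by apply: contraTneq rj => <-; rewrite -ltnNge.
(* No pair exists, so the claim about solutions in (i) is vacuous. Taking zero and E^T Q as the two
   matrices still gives (ii), since [pid_diag R n r *m Qt] is the transform of E^T Q. *)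
have [S [T [k [k2 [k3 [s [s2 [s3 [[uS uT ET] _ YT [kr srt p p2 p3]]]]]]]]]] :=
  balanced_coordinates (psd0 R n) pEQ (esym (mulmx0 _ E)) erefl.
exists S, T; split=> //; cbv zeta; rewrite AtE // CtE //.
set Qt := (invmx S)^T *m Q *m invmx T; split=> //.
  exists k, k2, k3, s, s2, s3; split=> // Pc Pf.
  move=> /(backC _ _ _ uS uT) gC /(backF _ _ _ uS uT) gF.
  by case: none; exists (S^T *m Pc *m T, invmx T *m Pf^T *m invmx S^T).
move=> uQ; have QtE : pid_diag R n r *m Qt = diagC n k k2 k3 s s3.
  have -> : pid_diag R n r = (invmx T)^T *m E^T *m S^T.
    by rewrite -[LHS]tr_diag_mx -/(pid_diag R n r) -ET !trmx_mul mulmxA.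
  by rewrite -YT /Qt !mulmxA -(mulmxA _ S^T) tS // mulmx1.
move=> i j ir; split=> [rj|_ ij]; apply: (mul_pid_diag_diag QtE ir) => //.
by apply: contraTneq rj => <-; rewrite -ltnNge.
Qed.
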